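(* Let $\alpha\in\mathbb{R}\setminus\mathbb{Q}$ and $\beta>0$. Let $g:\mathbb{R}^+\to\mathbb{R}^+$ satisfy $g(t)=t^{\beta}+o(t^{\beta})$ as $t\to+\infty$. Let $F:\mathbb{R}\to\mathbb{R}$ be a continuous $1$-periodic function with only isolated roots such that for every root $r\in\mathbb{R}$ of $F$ there exist $\gamma(r)>0$ and $c_r\in\mathbb{R}\setminus\{0\}$ with $$F(r+x)=c_r\cdot\epsilon(x)\cdot|x|^{\gamma(r)}+o\left(|x|^{\gamma(r)}\right)\quad\text{as }x\to0 .$$ Consider the sequence $\left(g(k)\cdot F(k\alpha)\right)_{k\in\mathbb{N}}$. 1. If the sequence $\left(g(k)F(k\alpha)\right)_{k\in\mathbb{N}}$ is dense in $\mathbb{R}^+$ (resp. in $\mathbb{R}^-$), then there exists a root $r$ of $F$ such that either $c_r>0$ (resp. $c_r<0$) and $\mu_+\left(\alpha,\frac{\beta}{\gamma(r)},r\right)=0$, or else $c_r<0$ (resp. $c_r>0$) and $\mu_-\left(\alpha,\frac{\beta}{\gamma(r)},r\right)=0$. Moreover, if the root $r$ is rational then this condition is also sufficient (that is, if there is a rational root $r$ of $F$ satisfying this condition, then the sequence is dense in $\mathbb{R}^+$ (resp. in $\mathbb{R}^-$)). 2. If there exists a root $r$ of $F$ such that either $c_r>0$ (resp. $c_r<0$) and $\tau_+\left(\alpha,\frac{\beta}{\gamma(r)},r\right)=0$, or else $c_r<0$ (resp. $c_r>0$) and $\tau_-\left(\alpha,\frac{\beta}{\gamma(r)},r\right)=0$,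 then the sequence $\left(g(k)F(k\alpha)\right)_{k\in\mathbb{N}}$ is dense in $\mathbb{R}^+$ (resp. in $\mathbb{R}^-$).
   Context: $\mathbb{N}=\{1,2,3,\dots\}$; $\mathbb{R}^+$ and $\mathbb{R}^-$ are the positive and negative reals. A real sequence is dense in a set $S\subseteq\mathbb{R}$ if the closure of its set of values contains $S$. For $x\in\mathbb{R}$, $\{x\}$ is the fractional part and $\{x\}_2$ is the signed fractional part, the unique number in $[-\frac12,\frac12)$ with $x-\{x\}_2\in\mathbb{Z}$. The sign function is $\epsilon(x)=1$ if $x>0$, $\epsilon(0)=0$, $\epsilon(x)=-1$ if $x<0$. For $\alpha\in\mathbb{R}\setminus\mathbb{Q}$, $\beta>0$, $\rho\in\mathbb{R}$ set $$\mu_+(\alpha,\beta,\rho)=\liminf_{k\to+\infty,\ \{k\alpha-\rho\}_2>0}k^\beta\{k\alpha-\rho\}_2,\qquad \mu_-(\alpha,\beta,\rho)=\liminf_{k\to+\infty,\ \{k\alpha-\rho\}_2<0}-k^\beta\{k\alpha-\rho\}_2 .$$ Let $\alpha=[a_0;a_1,a_2,\dots]$ be the continued fraction expansion of $\alpha$ and let $q_n$ be the denominators of its convergents ($q_0=1$, $q_1=a_1$, $q_{n+1}=a_{n+1}q_n+q_{n-1}$). The Ostrowski expansion of $\rho\in\mathbb{R}$ with base $\alpha$ is $$\rho=\rho_0+e_0(\rho)\{\alpha\}+\sum_{n=1}^{\infty}e_n(\rho)\{q_n\alpha\}_2,$$ with $\rho_0\in\mathbb{Z}$, $\rho-\rho_0\in[-\{\alpha\},1-\{\alpha\})$,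 and integers $0\le e_0(\rho)\le a_1-1$, $0\le e_n(\rho)\le a_{n+1}$ for $n\ge1$, such that $e_n(\rho)=0$ whenever $e_{n+1}(\rho)=a_{n+2}$ ($n\ge0$). Set $$\tau_+(\alpha,\beta,\rho)=\liminf_{n\to+\infty}\max\left\{1,\min\left\{e_{2n}(\rho)^\beta,(a_{2n+1}-e_{2n}(\rho))^{\frac{\beta+1}{2}}\right\}\right\}q_{2n}^\beta\{q_{2n}\alpha\}_2,$$ $$\tau_-(\alpha,\beta,\rho)=\liminf_{n\to+\infty}-\max\left\{1,\min\left\{e_{2n-1}(\rho)^\beta,(a_{2n}-e_{2n-1}(\rho))^{\frac{\beta+1}{2}}\right\}\right\}q_{2n-1}^\beta\{q_{2n-1}\alpha\}_2 .$$ *)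

(* Defs.v *)
From HB Require Import structures.
From mathcomp Require Export all_boot all_order all_algebra.
From mathcomp Require Export all_classical all_reals all_analysis.
Export Order.TTheory GRing.Theory Num.Theory.
Export numFieldNormedType.Exports.

Set Implicit Arguments.
Unset Strict Implicit.
Unset Printing Implicit Defensive.

Local Open Scope classical_set_scope.
Local Open Scope ring_scope.

(* Lets Landau notations take +oo as their filter. *)
Canonical pinfty_nbhs_filter_on (R : numFieldType) :=
  FilterType (pinfty_nbhs R) _.

Definition frac {R : realType} (x : R) : R := x - (Num.floor x)%:~R.
Definition sfrac {R : realType} (x : R) : R := x - (Num.floor (x + 2^-1))%:~R.

Lemma sfracP {R : realType} (x y : R) :
  - 2^-1 <= y < 2^-1 -> x - y \is a Num.int -> y = sfrac x.
Proof.
move=> /andP[y1 y2] /intrP[m xym]; rewrite /sfrac.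
suff -> : Num.floor (x + 2^-1) = m by rewrite -xym opprB addrC subrK.
have xE : x = m%:~R + y by rewrite -xym subrK.
apply: floor_def; rewrite xE -addrA lerDl intrD ltrD2l.
by rewrite -lerBlDr sub0r y1 [ltRHS](splitr 1) !div1r ltrD2r.
Qed.

(* For alpha irrational, no complete quotient is an integer, so the inverse is
   never taken at 0. *)
Fixpoint cf_quotient {R : realType} (alpha : R) (n : nat) : R :=
  if n is m.+1 then (frac (cf_quotient alpha m))^-1 else alpha.

Definition cf_coef {R : realType} (alpha : R) (n : nat) : int :=
  Num.floor (cf_quotient alpha n).

Fixpoint cf_denom {R : realType} (alpha : R) (n : nat) : int :=
  match n with
  | 0%N => 1
  | 1%N => cf_coef alpha 1
  | (m.+1 as k).+1 => cf_coef alpha k.+1 * cf_denom alpha k + cf_denom alpha m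
  end.

Definition is_ostrowski {R : realType} (alpha rho : R) (e : nat -> int) : Prop :=
  exists rho0 : int,
    [/\ - frac alpha <= rho - rho0%:~R < 1 - frac alpha,
        0 <= e 0%N <= cf_coef alpha 1 - 1,
        (forall n, (0 < n)%N -> 0 <= e n <= cf_coef alpha n.+1),
        (forall n, e n.+1 = cf_coef alpha n.+2 -> e n = 0) &
        rho0%:~R + (e 0%N)%:~R * frac alpha
          + \sum_(1 <= n < N) (e n)%:~R * sfrac ((cf_denom alpha n)%:~R * alpha)
          @[N --> \oo] --> rho].

(* Every rho has an expansion. It can fail to be unique only when rho is
   - j * alpha modulo 1 for some positive integer j; in every expansion of such a
   rho, e_n is 0 or a_(n+1) for all large n, so that the maximum in tau_term
   below is eventually 1 and the tau's do not depend on the choice. *)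
Definition ostrowski {R : realType} (alpha rho : R) : nat -> int :=
  xget (fun=> 0) [set e | is_ostrowski alpha rho e].

Definition mu_plus {R : realType} (alpha beta rho : R) : \bar R :=
  limf_einf (fun k : nat => (k%:R `^ beta * sfrac (k%:R * alpha - rho))%:E)
    (within [set k : nat | 0 < sfrac (k%:R * alpha - rho)] \oo).

Definition mu_minus {R : realType} (alpha beta rho : R) : \bar R :=
  limf_einf (fun k : nat => (- (k%:R `^ beta * sfrac (k%:R * alpha - rho)))%:E)
    (within [set k : nat | sfrac (k%:R * alpha - rho) < 0] \oo).

(* max {1, min {e_n^beta, (a_(n+1) - e_n)^((beta + 1) / 2)}}
     * q_n^beta * {q_n alpha}_2 *)
Definition tau_term {R : realType} (alpha beta rho : R) (n : nat) : R :=
  Num.max 1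
    (Num.min ((ostrowski alpha rho n)%:~R `^ beta)
       ((cf_coef alpha n.+1 - ostrowski alpha rho n)%:~R `^ ((beta + 1) / 2)))
  * (cf_denom alpha n)%:~R `^ beta * sfrac ((cf_denom alpha n)%:~R * alpha).

Definition tau_plus {R : realType} (alpha beta rho : R) : \bar R :=
  limn_einf (fun n => (tau_term alpha beta rho (2 * n))%:E).

(* The index is 2n - 1, truncated at n = 0 (which the limit does not see). *)
Definition tau_minus {R : realType} (alpha beta rho : R) : \bar R :=
  limn_einf (fun n => (- tau_term alpha beta rho (2 * n).-1)%:E).

Definition seq_dense_in {R : realType} (u : nat -> R) (S : set R) : Prop :=
  S `<=` closure [set u k | k in [set k : nat | (0 < k)%N]].

(* Main.v *)
(** Write [{k alpha - r}_2 = s x] with [s = 1] or [s = -1] and [x > 0]. Near a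
    root [r], [g(k) F(k alpha)] behaves like [s c_r (k^(beta/gamma) x)^gamma].
    Necessity follows by compactness: if [0 < g(k) F(k alpha)] takes arbitrarily
    small values, then [{k alpha}] clusters at a root along such [k].
    For sufficiency it is enough that, for the right sign [s], the numbers
    [k^b x], [b = beta/gamma], cluster at every positive real. They do so along an
    arithmetic progression [k = jQ + K], [x = jT + X], where consecutive values
    of [k^b x] have ratio close to [1] once [j] is large, as soon as one value with
    large [j] is small. For a rational root with denominator [d] and a
    good [k], take the multiples [(1 + jd) k]. In general, with [q_n] the
    denominators, [e_n] the Ostrowski digits of [r] and
    [k_n = e_0 q_0 + ... + e_(n-1) q_(n-1)], take [Q = q_n] and [K] equal to
    [k_(n+1)] or to [k_n - q_(n-1)]; the terms are then of order
    [e_n^b q_n^b |{q_n alpha}_2|] and [(a_(n+1) - e_n) q_n^b |{q_n alpha}_2|]. *)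
Require Import Defs.
From mathcomp Require Import ring lra zify.

Set Implicit Arguments.
Unset Strict Implicit.
Unset Printing Implicit Defensive.

Local Open Scope classical_set_scope.
Local Open Scope ring_scope.

(** * Continued fractions *)

Lemma frac_itv {R : realType} (x : R) : irrational x -> 0 < frac x < 1.
Proof.
move=> xirr; rewrite /frac subr_gt0 ltrBlDl lt_neqAle ge_floor andbT.
rewrite (_ : _ + 1 = (Num.floor x + 1)%:~R) ?floorD1_gt ?andbT; last by rewrite intrD.
by apply/eqP => xE; apply: xirr; exists (Num.floor x)%:~R; rewrite //= ratr_int.
Qed.

Lemma cf_quotient_irrational {R : realType} (alpha : R) (n : nat) :
  irrational alpha -> irrational (cf_quotient alpha n).
Proof.
move=> airr; elim: n => // n IHn [q _ qE]; apply: IHn.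
exists (q^-1 + (Num.floor (cf_quotient alpha n))%:~R) => //.
by rewrite rmorphD fmorphV /= ratr_int qE invrK /frac subrK.
Qed.

Lemma cf_coef_ge1 {R : realType} (alpha : R) (n : nat) :
  irrational alpha -> 1 <= cf_coef alpha n.+1.
Proof.
move=> airr; have /andP[f0 f1] := frac_itv (cf_quotient_irrational (n := n) airr).
by rewrite /cf_coef /= floor_ge_int ltW// invf_gt1.
Qed.

(* [|q_n alpha - p_n|], as the product of the fractional parts of the first
   complete quotients. *)
Fixpoint cf_dist {R : realType} (alpha : R) (n : nat) : R :=
  match n with
  | 0%N => frac alpha
  | m.+1 => cf_dist alpha m * frac (cf_quotient alpha m.+1)
  end.

Lemma cf_dist_gt0 {R : realType} (alpha : R) (n : nat) :
  irrational alpha -> 0 < cf_dist alpha n.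
Proof.
move=> airr; elim: n => [|n IHn] /=; first by case/andP: (frac_itv airr).
by case/andP: (frac_itv (cf_quotient_irrational (n := n.+1) airr)) => ? _; rewrite mulr_gt0.
Qed.

Lemma cf_dist_ltS {R : realType} (alpha : R) (n : nat) :
  irrational alpha -> cf_dist alpha n.+1 < cf_dist alpha n.
Proof.
move=> airr /=; case/andP: (frac_itv (cf_quotient_irrational (n := n.+1) airr)) => _ ?.
by rewrite gtr_pMr// cf_dist_gt0.
Qed.

Lemma cf_quotientD {R : realType} (alpha : R) (n : nat) :
  (frac (cf_quotient alpha n))^-1 =
    (cf_coef alpha n.+1)%:~R + frac (cf_quotient alpha n.+1).
Proof. by rewrite /cf_coef {2}/frac [RHS]addrC subrK. Qed.

Lemma cf_dist0 {R : realType} (alpha : R) : irrational alpha ->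
  1 = (cf_coef alpha 1)%:~R * cf_dist alpha 0 + cf_dist alpha 1.
Proof.
move=> airr; have /andP[f0 _] := frac_itv airr.
have fE := cf_quotientD alpha 0; rewrite /= in fE.
by rewrite [cf_dist alpha 1]/= [_ * cf_dist _ _]mulrC -mulrDr -fE mulfV ?gt_eqF.
Qed.

(** Multiply [cf_quotientD] by a distance: its last factor cancels the inverse. [cf_dist0] is the
    same relation one index lower, with 1 as the preceding distance. *)
Lemma cf_distS {R : realType} (alpha : R) (n : nat) : irrational alpha ->
  cf_dist alpha n = (cf_coef alpha n.+2)%:~R * cf_dist alpha n.+1 + cf_dist alpha n.+2.
Proof.
move=> airr; have /andP[f0 _] := frac_itv (cf_quotient_irrational (n := n.+1) airr).
have fE := cf_quotientD alpha n.+1.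
rewrite [cf_dist alpha n.+2]/= -[(_ * _) * _]mulrC [_ * cf_dist _ n.+1]mulrC.
rewrite [in X in _ = _ + X]mulrC -mulrDr -fE [cf_dist alpha n.+1]/= mulfK//.
by rewrite gt_eqF.
Qed.

Lemma cf_denomSS {R : realType} (alpha : R) (n : nat) :
  cf_denom alpha n.+2 = cf_coef alpha n.+2 * cf_denom alpha n.+1 + cf_denom alpha n.
Proof. by []. Qed.

(** Linear growth suffices to make the distances tend to 0. The induction carries two consecutive
    indices, as the recurrence has order two. *)
Lemma cf_denom_ge {R : realType} (alpha : R) (n : nat) :
  irrational alpha -> 1 <= cf_denom alpha n /\ (n : int) <= cf_denom alpha n.
Proof.
move=> airr.
suff: [/\ 1 <= cf_denom alpha n, (n : int) <= cf_denom alpha n,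
          1 <= cf_denom alpha n.+1 & (n.+1 : int) <= cf_denom alpha n.+1] by case.
elim: n => [|n [h1 h2 h3 h4]]; first by split => //; exact: cf_coef_ge1.
have := cf_coef_ge1 n.+1 airr; rewrite cf_denomSS.
set a := cf_coef _ _; set q := cf_denom _ _ in h1 h2 h3 h4 *.
set q' := cf_denom _ _ in h1 h2 h3 h4 *.
move=> a1; have : q' <= a * q' by nia.
by split; lia.
Qed.

(** Determinant identity of consecutive convergents: the two recurrences leave the left side
    invariant. *)
Lemma cf_denom_dist {R : realType} (alpha : R) (n : nat) : irrational alpha ->
  (cf_denom alpha n.+1)%:~R * cf_dist alpha n
    + (cf_denom alpha n)%:~R * cf_dist alpha n.+1 = 1.
Proof.
move=> airr; elim: n => [|n IHn]; first by rewrite [RHS](cf_dist0 airr)// mul1r.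
by rewrite -[RHS]IHn cf_denomSS (cf_distS n airr) intrD intrM; ring.
Qed.

Lemma cf_dist_le {R : realType} (alpha : R) (n : nat) : irrational alpha ->
  cf_dist alpha n <= (cf_denom alpha n.+1)%:~R^-1.
Proof.
move=> airr; have [q1 _] := cf_denom_ge n.+1 airr; have [q0 _] := cf_denom_ge n airr.
have q1R : 0 < (cf_denom alpha n.+1)%:~R :> R by rewrite ltr0z; lia.
rewrite -(ler_pM2l q1R) mulfV ?gt_eqF// -[leRHS](cf_denom_dist n airr) lerDl.
by rewrite mulr_ge0 ?ltW ?cf_dist_gt0// ltr0z; lia.
Qed.

(** Two steps of the recurrence bound twice this distance by an earlier one, or by 1. At index 0,
    [frac alpha] may exceed one half. *)
Lemma cf_dist_lt_half {R : realType} (alpha : R) (n : nat) :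
  irrational alpha -> (0 < n)%N -> cf_dist alpha n < 2^-1.
Proof.
move=> airr; case: n => // n _.
have an := cf_coef_ge1 n airr.
have := cf_dist_ltS n airr; have := cf_dist_gt0 n airr.
have : (1 : R) <= (cf_coef alpha n.+1)%:~R by rewrite ler1z.
case: n {an} => [|n]; first by have := cf_dist0 airr; nra.
have := cf_distS n airr; have := cf_dist_ltS n airr.
have : cf_dist alpha n <= 1.
  elim: n => [|n IHn]; first by case/andP: (frac_itv airr) => _ /ltW.
  exact: le_trans (ltW (cf_dist_ltS n airr)) IHn.
nra.
Qed.

(** With alternating signs the distances obey the recurrence of the denominators, so these
    differences obey it too; they are the numerators of the convergents. *)
Lemma cf_denomM_int {R : realType} (alpha : R) (n : nat) : irrational alpha ->
  (cf_denom alpha n)%:~R * alpha - (-1) ^+ n * cf_dist alpha n \is a Num.int.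
Proof.
move=> airr.
suff: ((cf_denom alpha n)%:~R * alpha - (-1) ^+ n * cf_dist alpha n \is a Num.int) /\
  ((cf_denom alpha n.+1)%:~R * alpha - (-1) ^+ n.+1 * cf_dist alpha n.+1 \is a Num.int).
  by case.
elim: n => [|n [IHn IHm]]; first split.
- by rewrite !mul1r /= /frac subKr intr_int.
- rewrite [_%:~R * _ - _](_ : _ = (cf_coef alpha 1 * Num.floor alpha + 1)%:~R) ?intr_int//.
  have -> : cf_dist alpha 1 = 1 - (cf_coef alpha 1)%:~R * frac alpha.
    by apply/esym/eqP; rewrite subr_eq addrC -(cf_dist0 airr).
  by rewrite expr1 intrD intrM /cf_denom /frac; ring.
split => //; rewrite [X in X \is a _](_ : _ = (cf_coef alpha n.+2)%:~R *
  ((cf_denom alpha n.+1)%:~R * alpha - (-1) ^+ n.+1 * cf_dist alpha n.+1) +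
  ((cf_denom alpha n)%:~R * alpha - (-1) ^+ n * cf_dist alpha n)); last first.
  by rewrite cf_denomSS (cf_distS n airr) intrD intrM !exprS; ring.
by rewrite rpredD// rpredM// intr_int.
Qed.

Lemma sfrac_cf_denomM {R : realType} (alpha : R) (n : nat) :
  irrational alpha -> (0 < n)%N ->
  sfrac ((cf_denom alpha n)%:~R * alpha) = (-1) ^+ n * cf_dist alpha n.
Proof.
move=> airr n0; apply/esym/sfracP; last exact: cf_denomM_int.
have := cf_dist_lt_half airr n0; have := cf_dist_gt0 n airr.
by rewrite -signr_odd; case: (odd n); rewrite /= ?expr1 ?expr0 => ? ?; apply/andP; lra.
Qed.

(** * Arithmetic progressions *)

(** [b] encodes a side: [false] when [k alpha] lies above [rho] modulo 1, [true] when it lies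
    below. *)
Definition clusters_at {R : realType} (b : bool) (alpha beta rho t : R) :=
  forall (eps : R) (N : nat), 0 < eps -> exists2 k : nat, (N <= k)%N &
    `|k%:R `^ beta * ((-1) ^+ b * sfrac (k%:R * alpha - rho)) - t| < eps.

Lemma nat_gt {R : realType} (x : R) : exists n : nat, x < n%:R.
Proof.
exists (Num.bound `|x|).
by apply: le_lt_trans (ler_norm x) _; apply: archi_boundP.
Qed.

Lemma sfrac_sign {R : realType} (b : bool) (x y : R) :
  0 < y < 2^-1 -> x - (-1) ^+ b * y \is a Num.int -> sfrac x = (-1) ^+ b * y.
Proof.
move=> /andP[y0 y1] xy; apply/esym/sfracP => //.
by case: b {xy}; rewrite ?expr1 ?expr0; apply/andP; lra.
Qed.

Lemma powRV_K {R : realType} (x r : R) : 0 <= x -> r != 0 -> (x `^ r^-1) `^ r = x.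
Proof. by move=> x0 r0; rewrite -powRrM mulVf// powRr1. Qed.

Lemma le_powR {R : realType} (r x y : R) :
  0 <= r -> 0 <= x -> x <= y -> x `^ r <= y `^ r.
Proof. by move=> r0 x0 xy; apply: ge0_ler_powR; rewrite // nnegrE ?(le_trans x0). Qed.

Lemma lt_powR {R : realType} (r x y : R) :
  0 < r -> 0 <= x -> x < y -> x `^ r < y `^ r.
Proof.
by move=> r0 x0 xy; apply: gt0_ltr_powR; rewrite // nnegrE ?(le_trans x0)// ltW.
Qed.

Lemma powR_ge1 {R : realType} (r x : R) : 0 <= r -> 1 <= x -> 1 <= x `^ r.
Proof. by move=> r0 x1; have := le_powR r0 ler01 x1; rewrite powR1. Qed.

(* f(j) = (jQ+K)^beta (jT+X) grows by a factor at most q^(beta+1) at each step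
   j >= J, where q > 1 is as close to 1 as J is large: if f(J) < t, then some
   f(j) is close to t. *)
Lemma progression_clusters {R : realType} (b : bool) (alpha beta rho t : R) :
  0 < beta -> 0 < t ->
  (forall (J N : nat) (eps : R), (2 <= J)%N -> 0 < eps ->
    exists (Q K : int) (T X : R),
    [/\ (N : int) <= Q, - Q <= K, 0 < T & - T <= X] /\
    [/\ Q%:~R * alpha - (-1) ^+ b * T \is a Num.int,
        K%:~R * alpha - rho - (-1) ^+ b * X \is a Num.int &
        (J%:R * Q%:~R + K%:~R) `^ beta * (J%:R * T + X) < eps]) ->
  clusters_at b alpha beta rho t.
Proof.
move=> beta0 t0 H eps N eps0.
pose eta := eps / t; have eta0 : 0 < eta by rewrite divr_gt0.
(* Since [q ^ (beta + 1) = 1 + eta], one step from a value at most [t] gains at most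
   [eta * t = eps]. *)
pose q := (1 + eta) `^ (beta + 1)^-1.
have q1 : 1 < q.
  have := @lt_powR R (beta + 1)^-1 1 (1 + eta).
  by rewrite powR1 invr_gt0; apply; lra.
have qE : q `^ beta * q = 1 + eta.
  rewrite -[X in _ * X = _]powRr1 -?powRD; first by rewrite powRV_K//; lra.
  - by apply/implyP => _; lra.
  - by lra.
(* Beyond [J0] the ratio [(m + 1) / m] is at most [q]; [N0] ensures [k ^ beta > 2 * t]. *)
have [J0 J0q] := nat_gt (q - 1)^-1.
have [N0 N0t] := nat_gt ((2 * t) `^ beta^-1).
have [Q [K [T [X [[QN KQ T0 XT] [QT KX fJ]]]]]] :=
  H J0.+2 (maxn (maxn N 1) N0) t isT t0.
have Q1 : 1 <= Q by lia.
pose f j : R := (j%:R * Q%:~R + K%:~R) `^ beta * (j%:R * T + X).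
have QR : 1 <= Q%:~R :> R by rewrite ler1z.
have KR : - Q%:~R <= K%:~R :> R by rewrite -intrN ler_int.
have base_ge j : (j.+1%:R * Q%:~R + K%:~R : R) >= j%:R * Q%:~R by rewrite -natr1; lra.
have dist_ge j : j.+1%:R * T + X >= j%:R * T by rewrite -natr1; lra.
have [j0 j0t] := nat_gt (t / T).
have fbig : exists j, (J0.+2 < j)%N && (t < f j).
  exists (maxn j0 J0.+2).+1; rewrite ltnS leq_maxr/=.
  have j0le : j0%:R <= (maxn j0 J0.+2)%:R :> R by rewrite ler_nat leq_maxl.
  have J0le : 1 <= (maxn j0 J0.+2)%:R :> R by rewrite ler1n leq_max orbT.
  move: (maxn _ _) j0le J0le => m m0 m1.
  have : 1 <= (m.+1%:R * Q%:~R + K%:~R : R) `^ beta.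
    by apply: powR_ge1; [lra|apply: le_trans (base_ge m); nra].
  have : t < m.+1%:R * T + X.
    apply: lt_le_trans (dist_ge m); rewrite -ltr_pdivrMr//.
    exact: lt_le_trans j0t m0.
  rewrite /f; nra.
(* At the predecessor of the least such index [f] is at most [t]: by minimality, or because the
   predecessor is [J0.+2], where [fJ] applies. *)
case: (ex_minnP fbig) => -[//|m] /andP[Jm tf] mmin.
have fm : f m <= t.
  move: Jm; rewrite ltnS leq_eqVlt => /predU1P[<-|Jm]; first exact: ltW.
  rewrite leNgt; apply/negP => tfm.
  by have := mmin m; rewrite Jm tfm ltnn => /(_ isT).
case: m Jm tf fm {mmin} => // m Jm tf fm.
have {}Jm : (J0 < m)%N by rewrite !ltnS in Jm.
have Jm' : (J0%:R : R) <= m%:R by rewrite ler_nat ltnW.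
have m1 : (1 : R) <= m%:R by rewrite ler1n (leq_ltn_trans _ Jm).
have qm : 1 <= (q - 1) * m%:R.
  rewrite -ler_pdivrMl ?mulr1; last lra.
  exact: le_trans (ltW J0q) _.
have base0 : 1 <= m.+1%:R * Q%:~R + K%:~R :> R by apply: le_trans (base_ge m); nra.
have dist0 : 0 < m.+1%:R * T + X by apply: lt_le_trans (dist_ge m); nra.
(* Both factors of [f] are affine in the index: the increment [c] is at most [(q - 1) * m * c],
   hence at most [q - 1] times the current value. *)
have scale (c d : R) : 0 <= c -> m%:R * c <= m.+1%:R * c + d ->
    m.+2%:R * c + d <= q * (m.+1%:R * c + d).
  move=> c0; rewrite -(natr1 m.+1) mulrDl mul1r addrAC; move: (_ + d) => z mz.
  have : c <= (q - 1) * m%:R * c by rewrite ler_peMl.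
  have : (q - 1) * (m%:R * c) <= (q - 1) * z by rewrite ler_pM2l// subr_gt0.
  lra.
have step : f m.+2 <= (1 + eta) * f m.+1.
  rewrite -qE /f mulrACA -powRM; [|lra|lra].
  apply: ler_pM; first exact: powR_ge0.
  - by apply: le_trans (dist_ge m.+1); rewrite mulr_ge0// ltW.
  - apply: le_powR; [lra| |by apply: scale; [lra|exact: base_ge]].
    by apply: le_trans (base_ge m.+1); rewrite mulr_ge0//; lra.
  - by apply: scale; [lra|exact: dist_ge].
have Qk : Q <= m.+1%:Z * Q + K.
  have m1Z : 1 <= m%:Z by rewrite lez_nat (leq_ltn_trans _ Jm).
  have -> : m.+1%:Z = m%:Z + 1 by rewrite -addn1 PoszD.
  by clear -m1Z Q1 KQ; nia.
have [k kE] : exists k : nat, k%:Z = m.+1%:Z * Q + K.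
  by exists (absz (m.+1%:Z * Q + K)); rewrite gez0_abs// (le_trans _ Qk)// (le_trans _ Q1).
have Mk : (maxn (maxn N 1) N0 <= k)%N by rewrite -lez_nat kE (le_trans QN).
have kR : k%:R = m.+1%:R * Q%:~R + K%:~R :> R.
  by rewrite pmulrn kE intrD intrM -pmulrn.
have NkR : N0%:R <= k%:R :> R by rewrite ler_nat (leq_trans _ Mk)// leq_maxr.
have kbig : 2 * t < k%:R `^ beta.
  rewrite -[ltLHS](@powRV_K R _ beta) ?gt_eqF//; last lra.
  exact: lt_powR (powR_ge0 _ _) (lt_le_trans N0t NkR).
have sk : sfrac (k%:R * alpha - rho) = (-1) ^+ b * (m.+1%:R * T + X).
  apply: sfrac_sign.
    (* A distance of at least one half would give a value of at least [k ^ beta / 2 > t]. *)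
    rewrite dist0 /= ltNge; apply/negP => dist_half.
    by move: fm; rewrite /f -kR; nra.
  rewrite kR (_ : _ - _ = m.+1%:R * (Q%:~R * alpha - (-1) ^+ b * T) +
    (K%:~R * alpha - rho - (-1) ^+ b * X)); last by ring.
  by rewrite rpredD// rpredM// natr_int.
exists k; first by rewrite (leq_trans _ Mk)// -maxnA leq_maxl.
rewrite sk signrMK kR -/(f m.+1) ler0_norm ?subr_le0//.
have : eta * t = eps by rewrite divfK// gt_eqF.
have : 0 < f m.+1 by rewrite mulr_gt0// powR_gt0; lra.
nra.
Qed.

(** * Inferior limits and rational roots *)

Lemma limf_einf0_lt {R : realType} (F : set_system nat) (f : nat -> R)
    (V : set nat) (eps : R) :
  limf_einf (EFin \o f) F = 0%E -> F V -> 0 < eps ->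
  exists2 k, V k & f k < eps.
Proof.
rewrite limf_einfE => f0 FV eps0; apply: contrapT => nex.
suff : (eps%:E <= 0)%E by rewrite lee_fin leNgt eps0.
rewrite -f0; apply: (@le_trans _ _ (ereal_inf ((EFin \o f) @` V))); last first.
  by apply: ereal_sup_ubound; exists V.
apply: le_ereal_inf_tmp => _ [k Vk <-]; rewrite lee_fin leNgt; apply/negP => fk.
by apply: nex; exists k.
Qed.

(** Nonnegativity gives the lower bound 0. If [D] had no large elements, the infimum over the empty
    set would make the lower limit [+oo]. *)
Lemma limf_einf_within0P {R : realType} (D : set nat) (f : nat -> R) :
  (forall k, D k -> 0 <= f k) ->
  limf_einf (EFin \o f) (within D \oo) = 0%E <->
  (forall (eps : R) (N : nat), 0 < eps -> exists2 k, (N <= k)%N & D k /\ f k < eps).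
Proof.
move=> f0; split=> [fl eps N eps0|H].
  have [|k [Nk Dk] fk] := limf_einf0_lt (V := [set k | (N <= k)%N /\ D k]) fl _ eps0.
    by exists N => // k Nk Dk; split.
  by exists k.
rewrite limf_einfE; apply/eqP; rewrite eq_le; apply/andP; split.
  apply: ge_ereal_sup => _ [V [N _ NV] <-].
  apply/lee_addgt0Pr => eps eps0; rewrite add0e.
  have [k Nk [Dk fk]] := H eps N eps0.
  apply: (le_trans (y := (f k)%:E)); last by rewrite lee_fin ltW.
  by apply: ereal_inf_lbound; exists k => //; exact: NV.
apply: (@le_trans _ _ (ereal_inf ((EFin \o f) @` D))); last first.
  by apply: ereal_sup_ubound; exists D => //; exists 0%N.
by apply: le_ereal_inf_tmp => _ [k Dk <-]; rewrite lee_fin f0.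
Qed.

Definition approximable {R : realType} (b : bool) (alpha beta rho : R) :=
  forall (eps : R) (N : nat), 0 < eps -> exists2 k : nat, (N <= k)%N &
    0 < (-1) ^+ b * sfrac (k%:R * alpha - rho) /\
    k%:R `^ beta * ((-1) ^+ b * sfrac (k%:R * alpha - rho)) < eps.

Lemma mu_plus_eq0P {R : realType} (alpha beta rho : R) :
  mu_plus alpha beta rho = 0%E <-> approximable false alpha beta rho.
Proof.
apply: iff_trans (limf_einf_within0P _) _ => [k /= Dk|].
  by rewrite mulr_ge0 ?powR_ge0// ltW.
split=> H eps N eps0; have [k Nk] := H eps N eps0.
  by exists k; rewrite // expr0 mul1r.
by rewrite expr0 mul1r => ?; exists k.
Qed.

Lemma mu_minus_eq0P {R : realType} (alpha beta rho : R) :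
  mu_minus alpha beta rho = 0%E <-> approximable true alpha beta rho.
Proof.
apply: iff_trans (limf_einf_within0P _) _ => [k /= Dk|].
  by rewrite oppr_ge0 mulr_ge0_le0 ?powR_ge0// ltW.
split=> H eps N eps0; have [k Nk] := H eps N eps0.
  by exists k; rewrite // expr1 mulN1r mulrN oppr_gt0.
by rewrite expr1 mulN1r mulrN oppr_gt0 => ?; exists k.
Qed.

(** Let [d] be the denominator of [rho]. As [(1 + j d) rho] is [rho] modulo 1, replacing a good [k]
    by [(1 + j d) k] multiplies its distance by [1 + j d]. *)
Lemma rational_clusters_at {R : realType} (b : bool) (alpha beta rho t : R) :
  0 < beta -> 0 < t -> rational rho ->
  approximable b alpha beta rho -> clusters_at b alpha beta rho t.
Proof.
move=> beta0 t0 [r _ rE] H; apply: progression_clusters => // J N eps _ eps0.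
pose d : R := (denq r)%:~R; have d0 : 0 < d by rewrite ltr0z denq_gt0.
have drho : d * rho \is a Num.int.
  rewrite -rE /ratr mulrC divfK ?intr_int// gt_eqF//.
(* [m] is the multiplier at [j = J]; it scales the value by [m ^ (beta + 1)], whence the tolerance
   [eps / (m ^ beta * m)]. *)
pose m := J%:R * d + 1.
have m0 : 0 < m by rewrite ltr_wpDl// mulr_ge0// ltW.
have c0 : 0 < m `^ beta * m by rewrite mulr_gt0// powR_gt0.
have [k Nk []] := H (eps / (m `^ beta * m)) (maxn N 1) (divr_gt0 eps0 c0).
set s := sfrac _; set y := _ * s => y0 ky.
exists (denq r * k%:Z), k%:Z, (d * y), y; split; first split.
- have := denq_gt0 r; clear -Nk; nia.
- have := denq_gt0 r; clear -Nk; nia.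
- by rewrite mulr_gt0.
- by rewrite (le_trans _ (ltW y0))// oppr_le0 ltW// mulr_gt0.
have ks : k%:R * alpha - rho - s \is a Num.int by rewrite /s /sfrac subKr intr_int.
split.
- rewrite intrM -pmulrn [X in X \is a _](_ : _ = d * (k%:R * alpha - rho - s) + d * rho).
    by rewrite rpredD// rpredM// intr_int.
  by rewrite mulrCA signrMK /d; ring.
- by rewrite -pmulrn signrMK.
- move: ky; rewrite ltr_pdivlMr// => ky.
  have -> : J%:R * (denq r * k%:Z)%:~R + k%:Z%:~R = m * k%:R :> R.
    by rewrite intrM -pmulrn /m /d; ring.
  have -> : J%:R * (d * y) + y = m * y by rewrite /m; ring.
  by rewrite powRM ?ler0n ?(ltW m0)// mulrACA mulrC.
Qed.

(** * Ostrowski expansions *)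

(* [|q_(n-1) alpha - p_(n-1)|], with the convention [q_(-1) alpha - p_(-1) = -1]. *)
Definition cf_dist_pred {R : realType} (alpha : R) (n : nat) : R :=
  if n is m.+1 then cf_dist alpha m else 1.

Lemma cf_dist_predE {R : realType} (alpha : R) (n : nat) : irrational alpha ->
  cf_dist_pred alpha n = (cf_coef alpha n.+1)%:~R * cf_dist alpha n + cf_dist alpha n.+1.
Proof. by case: n => [|n] airr; [exact: cf_dist0|exact: cf_distS]. Qed.

(** The term of index 0 is a multiple of [frac alpha], so one formula covers the separate first
    digit of the expansion. *)
Definition ostrowski_sum {R : realType} (alpha : R) (e : nat -> int) (n : nat) : R :=
  \sum_(i < n) (e i)%:~R * ((-1) ^+ i * cf_dist alpha i).

Lemma ostrowski_sumE {R : realType} (alpha : R) (e : nat -> int) (n : nat) :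
  irrational alpha ->
  (e 0%N)%:~R * frac alpha
    + \sum_(1 <= i < n.+1) (e i)%:~R * sfrac ((cf_denom alpha i)%:~R * alpha)
  = ostrowski_sum alpha e n.+1.
Proof.
move=> airr; rewrite /ostrowski_sum -(big_mkord xpredT
  (fun i => (e i)%:~R * ((-1) ^+ i * cf_dist alpha i))) big_ltn// expr0 mul1r.
by congr (_ + _); apply: eq_big_nat => i /andP[i0 _]; rewrite sfrac_cf_denomM.
Qed.

Lemma cvg_ostrowski_sum {R : realType} (alpha rho : R) (rho0 : int) (e : nat -> int) :
  irrational alpha ->
  (rho0%:~R + (e 0%N)%:~R * frac alpha
    + \sum_(1 <= n < N) (e n)%:~R * sfrac ((cf_denom alpha n)%:~R * alpha)
    @[N --> \oo] --> rho) <->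
  (rho0%:~R + ostrowski_sum alpha e n @[n --> \oo] --> rho).
Proof.
move=> airr; split; apply: cvg_trans; apply: near_eq_cvg; exists 1%N => // -[//|n] _.
  by rewrite -addrA ostrowski_sumE.
by rewrite -addrA ostrowski_sumE.
Qed.

(** [D], [D'] and [Dp] are the current, next and previous distances. Minimality of a positive [e]
    gives the third conclusion; chained with the fourth at the next index, it yields the rule on
    maximal digits. *)
Lemma ostrowski_digit_step {R : realType} (a : int) (D D' Dp y : R) :
  1 <= a -> 0 < D -> 0 < D' -> Dp = a%:~R * D + D' -> - D <= y <= Dp ->
  let e := Num.max 0 (Num.ceil ((y - D') / D)) in
  [/\ 0 <= e <= a, - D' <= e%:~R * D - y <= D,
      e != 0 -> e%:~R * D - y < D - D' & y < Dp - D -> e <= a - 1].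
Proof.
move=> a1 D0 D'0 DpE /andP[yl yu] /=.
have [cM cm] := (ceil_ge ((y - D') / D), ceilB1_lt ((y - D') / D)).
rewrite ler_pdivrMr// in cM; rewrite ltr_pdivlMr// intrB mulrBl mul1r in cm.
have le_c (b : int) : y <= b%:~R * D + D' -> Num.ceil ((y - D') / D) <= b.
  by rewrite ceil_le_int ler_pdivrMr// lerBlDr.
have ca : Num.ceil ((y - D') / D) <= a by apply: le_c; rewrite -DpE.
have ca1 : y < Dp - D -> Num.ceil ((y - D') / D) <= a - 1.
  by move=> ylt; apply: le_c; rewrite intrB mulrBl mul1r; lra.
move: (Num.ceil _) cM cm ca ca1 => c cM cm ca ca1.
case: (leP c 0) => c0 /=; last first.
  split; [by rewrite ca ltW| | |exact: ca1]; last by move=> _; lra.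
  by apply/andP; split; lra.
have cD : c%:~R * D <= 0 by rewrite mulr_le0_ge0 ?lerz0// ltW.
split; [lia| |by []|lia].
by rewrite mul0r; apply/andP; split; lra.
Qed.

(* Up to the sign [(-1) ^ n], what remains of [x] after [n] Ostrowski digits; the
   next digit is the least [e >= 0] for which the new remainder is at least
   [- cf_dist alpha n.+1]. *)
Fixpoint ostrowski_rem {R : realType} (alpha x : R) (n : nat) : R :=
  if n is m.+1 then
    (Num.max 0 (Num.ceil ((ostrowski_rem alpha x m - cf_dist alpha m.+1)
                            / cf_dist alpha m)))%:~R * cf_dist alpha m
      - ostrowski_rem alpha x m
  else x.

Lemma cf_dist_small {R : realType} (alpha eps : R) : irrational alpha -> 0 < eps ->
  exists N : nat, forall n, (N <= n)%N -> cf_dist alpha n < eps.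
Proof.
move=> airr eps0; have [N epsN] := nat_gt eps^-1; exists N => n Nn.
apply: le_lt_trans (cf_dist_le n airr) _.
have [_ nq] := cf_denom_ge n.+1 airr.
have Nq : N%:R <= (cf_denom alpha n.+1)%:~R :> R.
  by rewrite pmulrn ler_int (le_trans _ nq)// lez_nat ltnW.
by rewrite invf_plt ?posrE// ?(lt_le_trans epsN)// (lt_le_trans _ Nq)//
  (lt_trans _ epsN)// invr_gt0.
Qed.

(** Existence keeps [ostrowski] from being the default value of [xget]. The greedy remainders stay
    in intervals shrinking to 0. *)
Lemma ostrowski_exists {R : realType} (alpha rho : R) : irrational alpha ->
  exists e, is_ostrowski alpha rho e.
Proof.
move=> airr; pose rho0 := Num.floor (rho + frac alpha).
pose x := rho - rho0%:~R; pose y := ostrowski_rem alpha x.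
pose e n := Num.max 0 (Num.ceil ((y n - cf_dist alpha n.+1) / cf_dist alpha n)).
have yS n : y n.+1 = (e n)%:~R * cf_dist alpha n - y n by [].
have x_itv : - frac alpha <= x < 1 - frac alpha.
  have := ge_floor (rho + frac alpha); have := floorD1_gt (rho + frac alpha).
  by rewrite /x -/rho0 intrD => ? ?; apply/andP; split; lra.
have step n : - cf_dist alpha n <= y n <= cf_dist_pred alpha n ->
    [/\ 0 <= e n <= cf_coef alpha n.+1,
        - cf_dist alpha n.+1 <= y n.+1 <= cf_dist_pred alpha n.+1,
        e n != 0 -> y n.+1 < cf_dist_pred alpha n.+1 - cf_dist alpha n.+1 &
        y n < cf_dist_pred alpha n - cf_dist alpha n -> e n <= cf_coef alpha n.+1 - 1].
  exact: ostrowski_digit_step (cf_coef_ge1 n airr) (cf_dist_gt0 n airr)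
    (cf_dist_gt0 n.+1 airr) (cf_dist_predE n airr).
have y_itv n : - cf_dist alpha n <= y n <= cf_dist_pred alpha n.
  elim: n => [|n /step[]//]; case/andP: x_itv => xl xu.
  rewrite {1}/y /= xl /y/= ltW// (lt_trans xu)//.
  by have := cf_dist_gt0 0 airr => /=; lra.
have sumE n : x - ostrowski_sum alpha e n = (-1) ^+ n * y n.
  elim: n => [|n IHn]; first by rewrite /ostrowski_sum big_ord0 subr0 expr0 mul1r.
  rewrite /ostrowski_sum big_ord_recr /= opprD addrA IHn yS exprS; ring.
exists e, rho0; split => //.
(* At index 0 the premise of the fourth conclusion is [x < 1 - frac alpha], whence the bound
   [a_1 - 1]. *)
- have [/andP[-> _] _ _ /(_ _)->//] := step 0%N (y_itv 0%N).
  by case/andP: x_itv.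
- by move=> n _; have [] := step n (y_itv n).
(* A nonzero digit leaves a remainder too small for the next digit to be maximal. *)
- move=> n en1; apply/eqP; apply: contrapT => /negP en.
  have [_ _ /(_ en) yn _] := step n (y_itv n).
  have [_ _ _ /(_ yn)] := step n.+1 (y_itv n.+1).
  by rewrite en1; lia.
apply/cvg_ostrowski_sum => //; apply/cvgrPdist_lt => eps eps0.
have [N DN] := cf_dist_small airr eps0.
exists N.+1 => // -[//|n] /= Nn.
rewrite opprD addrA sumE normrMsign ltr_norml.
have := y_itv n.+1; have := DN n.+1 (ltnW Nn); have := DN n Nn => /= ? ? /andP[? ?].
by apply/andP; split; lra.
Qed.

Lemma ostrowskiP {R : realType} (alpha rho : R) : irrational alpha ->
  is_ostrowski alpha rho (ostrowski alpha rho).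
Proof.
move=> airr; have [e he] := ostrowski_exists rho airr.
by apply: (@xgetPex _ (fun=> 0) _ (ex_intro _ e he)).
Qed.

(** A block starting at [n] is its first term minus the block starting at [n.+1]; the recurrence of
    the distances closes the induction. *)
Lemma ostrowski_block_itv {R : realType} (alpha : R) (e : nat -> int) (L n : nat) :
  irrational alpha -> (forall i, 0 <= e i <= cf_coef alpha i.+1) ->
  - cf_dist alpha n <=
    \sum_(i < L) (e (n + i)%N)%:~R * ((-1) ^+ i * cf_dist alpha (n + i)%N)
  <= cf_dist_pred alpha n.
Proof.
move=> airr e_itv; elim: L n => [|L IHL] n.
  rewrite big_ord0 oppr_le0 ltW ?cf_dist_gt0//=.
  by case: n => [|n] /=; rewrite ?ler01 ?ltW ?cf_dist_gt0.
rewrite big_ord_recl addn0 expr0 mul1r.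
rewrite (eq_bigr (fun i : 'I_L => - ((e (n.+1 + i)%N)%:~R *
    ((-1) ^+ i * cf_dist alpha (n.+1 + i)%N)))); last first.
  by move=> i _; rewrite /= /bump add1n addnS addSn exprS mulN1r mulNr mulrN.
rewrite sumrN; case/andP: (IHL n.+1) => lo hi.
have D0 := cf_dist_gt0 n airr; rewrite (cf_dist_predE n airr).
have [e0 ea] : 0 <= (e n)%:~R :> R /\ (e n)%:~R <= (cf_coef alpha n.+1)%:~R :> R.
  by rewrite ler0z ler_int; have /andP[] := e_itv n.
have : 0 <= (e n)%:~R * cf_dist alpha n by rewrite mulr_ge0 // ltW.
have : (e n)%:~R * cf_dist alpha n <= (cf_coef alpha n.+1)%:~R * cf_dist alpha n.
  by rewrite ler_pM2r.
rewrite [cf_dist_pred _ _]/= in hi.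
move: (\sum_(i < L) _) lo hi => s lo hi *.
by apply/andP; split; lra.
Qed.

Lemma ostrowski_tail_itv {R : realType} (alpha rho : R) (rho0 : int)
    (e : nat -> int) (n : nat) :
  irrational alpha -> (forall i, 0 <= e i <= cf_coef alpha i.+1) ->
  rho0%:~R + ostrowski_sum alpha e n @[n --> \oo] --> rho ->
  - cf_dist alpha n <= (-1) ^+ n * (rho - rho0%:~R - ostrowski_sum alpha e n)
    <= cf_dist_pred alpha n.
Proof.
move=> airr e_itv cvg_rho.
pose s L := (-1) ^+ n * (rho0%:~R + ostrowski_sum alpha e (L + n)%N
  - (rho0%:~R + ostrowski_sum alpha e n)).
have s_itv L : - cf_dist alpha n <= s L <= cf_dist_pred alpha n.
  rewrite (_ : s L = \sum_(i < L) (e (n + i)%N)%:~R *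
    ((-1) ^+ i * cf_dist alpha (n + i)%N)); first exact: ostrowski_block_itv.
  rewrite /s (addnC L) opprD addrACA subrr add0r /ostrowski_sum big_split_ord /=.
  rewrite addrAC subrr add0r.
  rewrite mulr_sumr; apply: eq_bigr => i _.
  by rewrite exprD mulrCA -mulrA signrMK.
have cvg_s : s L @[L --> \oo] --> (-1) ^+ n * (rho - rho0%:~R - ostrowski_sum alpha e n).
  rewrite -addrA -opprD; apply: cvgMr; apply: cvgB; last exact: cvg_cst.
  by move: cvg_rho; rewrite -(cvg_shiftn n).
rewrite -(cvg_lim _ cvg_s)//; apply/andP; split.
  by apply: limr_ge; [apply/cvg_ex; eexists; exact: cvg_s|];
    apply: nearW => L; case/andP: (s_itv L).
by apply: limr_le; [apply/cvg_ex; eexists; exact: cvg_s|];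
    apply: nearW => L; case/andP: (s_itv L).
Qed.

(** The integers [k_n]: modulo 1, [k_n alpha] is the partial sum of the expansion. *)
Definition ostrowski_denom {R : realType} (alpha : R) (e : nat -> int) (n : nat) : int :=
  \sum_(i < n) e i * cf_denom alpha i.

Lemma ostrowski_denom_int {R : realType} (alpha : R) (e : nat -> int) (n : nat) :
  irrational alpha ->
  (ostrowski_denom alpha e n)%:~R * alpha - ostrowski_sum alpha e n \is a Num.int.
Proof.
move=> airr; elim: n => [|n IHn].
  by rewrite /ostrowski_denom /ostrowski_sum !big_ord0 mul0r subr0 int_num0.
rewrite /ostrowski_denom /ostrowski_sum !big_ord_recr /= -!/(ostrowski_denom _ _ _)
  -!/(ostrowski_sum _ _ _).
rewrite (_ : _ - _ = ((ostrowski_denom alpha e n)%:~R * alpha - ostrowski_sum alpha e n) +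
  (e n)%:~R * ((cf_denom alpha n)%:~R * alpha - (-1) ^+ n * cf_dist alpha n)).
  by rewrite rpredD// rpredM ?intr_int ?cf_denomM_int.
by rewrite intrD intrM; ring.
Qed.

Definition cf_denom_pred {R : realType} (alpha : R) (n : nat) : int :=
  if n is m.+1 then cf_denom alpha m else 0.

Lemma ostrowski_denom_itv {R : realType} (alpha : R) (e : nat -> int) (n : nat) :
  irrational alpha -> (forall i, 0 <= e i <= cf_coef alpha i.+1) ->
  0 <= ostrowski_denom alpha e n <= 2 * cf_denom alpha n.
Proof.
move=> airr e_itv.
(* The induction needs the sharper bound [q_n + q_(n-1)]: adding [a_(n+1) q_n] turns it into
   [q_(n+1) + q_n]. *)
suff [/andP[-> h1] h2] : 0 <= ostrowski_denom alpha e n <=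
    cf_denom alpha n + cf_denom_pred alpha n /\ cf_denom_pred alpha n <= cf_denom alpha n.
  by rewrite (le_trans h1)//; lia.
have q_ge0 m : 1 <= cf_denom alpha m by have [] := cf_denom_ge m airr.
elim: n => [|n [IHn IHq]]; first by rewrite /ostrowski_denom big_ord0.
have a1 := cf_coef_ge1 n airr; have qn := q_ge0 n; have /andP[en0 ena] := e_itv n.
have qS : cf_denom alpha n.+1 = cf_coef alpha n.+1 * cf_denom alpha n +
    cf_denom_pred alpha n.
  by case: (n) => [|m] //; rewrite mulr1 addr0.
have q'0 : 0 <= cf_denom_pred alpha n.
  by case: (n) => // m; apply: le_trans (q_ge0 m).
rewrite /ostrowski_denom big_ord_recr /= -/(ostrowski_denom _ _ _).
rewrite -/(cf_denom alpha n.+1) qS.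
move: (ostrowski_denom _ _ _) (cf_denom_pred _ _) (cf_denom _ n) (cf_coef _ _) (e n)
  IHn IHq a1 qn en0 ena q'0 => {qS q_ge0 e_itv}.
move=> k q' q a d; nia.
Qed.

(** [A] and [B] absorb the digits: the base is at most [(J + 3) * A * q] and the distance at most
    [(J + 3) * B * D]. *)
Lemma progression_le {R : realType} (beta q D J K X A B : R) :
  0 <= beta -> 1 <= q -> 0 < D -> 2 <= J -> - q <= K -> - D <= X -> 1 <= A -> 1 <= B ->
  K <= 2 * A * q + q -> X <= 2 * D + B * D ->
  (J * q + K) `^ beta * (J * D + X)
    <= (J + 3) `^ beta * (J + 3) * (A `^ beta * B) * (q `^ beta * D).
Proof.
move=> beta0 q1 D0 J2 KQ XD A1 B1 KA XB.
have J3 : 0 <= J + 3 by lra.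
rewrite (_ : _ * _ * _ * _ =
  ((J + 3) `^ beta * A `^ beta * q `^ beta) * ((J + 3) * B * D)); last by ring.
have A0 : 0 <= A by lra.
have q0 : 0 <= q by lra.
rewrite -!powRM ?mulr_ge0//.
have Aq : q <= A * q by rewrite ler_peMl.
have BD : D <= B * D by rewrite ler_peMl// ltW.
apply: ler_pM; [exact: powR_ge0|nra| |].
  apply: le_powR => //; first nra.
  have : J * q <= J * (A * q) by rewrite ler_wpM2l//; lra.
  lra.
have : J * D <= J * (B * D) by rewrite ler_wpM2l//; lra.
lra.
Qed.

(* The first bound is reached with [K = k_(n+1)], the second with
   [K = k_n - q_(n-1)]: subtracting [q_(n-1)] replaces the digit [e_n] by
   [a_(n+1) - e_n], since [|q_(n-1) alpha - p_(n-1)|] is about [a_(n+1)] times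
   [|q_n alpha - p_n|]. *)
Lemma ostrowski_progression {R : realType} (alpha beta rho : R) (rho0 : int)
    (e : nat -> int) (n : nat) :
  irrational alpha -> 0 < beta -> (forall i, 0 <= e i <= cf_coef alpha i.+1) ->
  rho0%:~R + ostrowski_sum alpha e n @[n --> \oo] --> rho -> (0 < n)%N ->
  exists (K : int) (X : R),
    [/\ - cf_denom alpha n <= K, - cf_dist alpha n <= X,
        K%:~R * alpha - rho - (-1) ^+ n * X \is a Num.int &
        forall J : R, 2 <= J ->
        (J * (cf_denom alpha n)%:~R + K%:~R) `^ beta * (J * cf_dist alpha n + X)
          <= (J + 3) `^ beta * (J + 3) *
             Num.min (Num.max 1 (e n)%:~R `^ beta)
                     (Num.max 1 (cf_coef alpha n.+1 - e n)%:~R) *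
             ((cf_denom alpha n)%:~R `^ beta * cf_dist alpha n)].
Proof.
move=> airr beta0 e_itv cvg_rho n0.
have [q1 _] := cf_denom_ge n airr.
have D0 := cf_dist_gt0 n airr.
have qR : 1 <= (cf_denom alpha n)%:~R :> R by rewrite ler1z.
have /andP[k0 k2] := ostrowski_denom_itv n airr e_itv.
have /andP[kS0 _] := ostrowski_denom_itv n.+1 airr e_itv.
have [e0 ea] : 0 <= (e n)%:~R :> R /\ (e n)%:~R <= (cf_coef alpha n.+1)%:~R :> R.
  by rewrite ler0z ler_int; have /andP[] := e_itv n.
have sumS : ostrowski_sum alpha e n.+1 =
    ostrowski_sum alpha e n + (e n)%:~R * ((-1) ^+ n * cf_dist alpha n).
  by rewrite /ostrowski_sum big_ord_recr.
have denomS : ostrowski_denom alpha e n.+1 =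
    ostrowski_denom alpha e n + e n * cf_denom alpha n.
  by rewrite /ostrowski_denom big_ord_recr.
have /andP[tl tu] := ostrowski_tail_itv n.+1 airr e_itv cvg_rho.
have DS := cf_dist_ltS n airr; have DS0 := cf_dist_gt0 n.+1 airr.
have sgn : (-1) ^+ n * (-1) ^+ n = 1 :> R by rewrite -expr2 sqrr_sign.
have KInt := ostrowski_denom_int e n.+1 airr.
(* [s] is the offset of [k_(n+1) alpha] from [rho] modulo 1, up to the sign [(-1) ^ n]; it lies
   between [- cf_dist alpha n.+1] and [cf_dist alpha n]. *)
pose s : R := (-1) ^+ n.+1 * (rho - rho0%:~R - ostrowski_sum alpha e n.+1).
have sE : (-1) ^+ n * s = ostrowski_sum alpha e n.+1 - (rho - rho0%:~R).
  by rewrite /s exprS mulN1r mulNr mulrN mulrA sgn; ring.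
rewrite -/s [cf_dist_pred _ _]/= in tl tu.
(* Each branch attains the smaller bound. In the first the digit enters through [K] alone:
   [A = max 1 e_n] and [B = 1]. *)
case: (leP (Num.max 1 (e n)%:~R `^ beta)) => _.
  exists (ostrowski_denom alpha e n.+1), s; split.
  - by rewrite (le_trans _ kS0)// oppr_le0 (le_trans ler01).
  - by lra.
  - rewrite sE (_ : _ - _ =
      ((ostrowski_denom alpha e n.+1)%:~R * alpha - ostrowski_sum alpha e n.+1) - rho0%:~R).
      by rewrite rpredB// intr_int.
    by ring.
  move=> J J2; rewrite -[Num.max 1 _ `^ beta]mulr1.
  apply: progression_le => //; rewrite ?le_max ?lexx//.
  - by lra.
  - by rewrite -intrN ler_int (le_trans _ kS0)// oppr_le0 (le_trans ler01).
  - by lra.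
  - have k2R : (ostrowski_denom alpha e n)%:~R <= 2 * (cf_denom alpha n)%:~R :> R.
      by rewrite -[2]/(2%:~R) -intrM ler_int.
    rewrite denomS intrD intrM.
    have m1 : 1 <= Num.max 1 (e n)%:~R :> R by rewrite le_max lexx.
    have me : (e n)%:~R <= Num.max 1 (e n)%:~R :> R by rewrite le_max lexx orbT.
    move: (Num.max _ _) m1 me => m m1 me; nra.
  - by lra.
have /andP[_ tn] := ostrowski_tail_itv n airr e_itv cvg_rho.
have tnE : (-1) ^+ n * (rho - rho0%:~R - ostrowski_sum alpha e n) =
    (e n)%:~R * cf_dist alpha n - s.
  rewrite /s sumS opprD [in RHS]addrA exprS mulN1r mulNr opprK [in RHS]mulrBr.
  by rewrite (mulrCA _ (e n)%:~R) signrMK [RHS]addrC subrK.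
rewrite tnE in tn.
have DpE := cf_dist_predE n airr.
have predInt : (cf_denom_pred alpha n)%:~R * alpha
    + (-1) ^+ n * cf_dist_pred alpha n \is a Num.int.
  case: (n) n0 => // m _; have := cf_denomM_int m airr.
  by rewrite exprS mulN1r mulNr.
have qp : 0 <= cf_denom_pred alpha n <= cf_denom alpha n.
  case: (n) n0 => // m _; have [qm _] := cf_denom_ge m airr.
  rewrite /cf_denom_pred (le_trans _ qm)// andTb.
  case: m qm => [|m] qm; first by have [] := cf_denom_ge 1 airr.
  have := cf_coef_ge1 m.+1 airr; have [qm' _] := cf_denom_ge m airr.
  rewrite cf_denomSS; move: (cf_coef _ _) (cf_denom _ _) (cf_denom _ m) qm qm'.
  by clear; move=> a q q'; nia.
have KQ : - cf_denom alpha n <= ostrowski_denom alpha e n - cf_denom_pred alpha n.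
  by move: k0 qp; clear; lia.
(* Here [A = 1] and the digit enters through the distance, equal to
   [(a_(n+1) - e_n) D_n + D_(n+1) + s] with [D_n] for [cf_dist alpha n]; [tn] makes it
   nonnegative. *)
exists (ostrowski_denom alpha e n - cf_denom_pred alpha n),
  (cf_dist_pred alpha n - ((e n)%:~R * cf_dist alpha n - s)); split.
- exact: KQ.
- by lra.
- rewrite -tnE (_ : _ - _ =
    ((ostrowski_denom alpha e n)%:~R * alpha - ostrowski_sum alpha e n) - rho0%:~R
    - ((cf_denom_pred alpha n)%:~R * alpha + (-1) ^+ n * cf_dist_pred alpha n)).
    by rewrite rpredB// rpredB ?intr_int// ostrowski_denom_int.
  by rewrite intrB mulrBr mulrA sgn; ring.
move=> J J2; have one_pow : 1 `^ beta = 1 :> R by rewrite powR1.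
rewrite -[Num.max _ _]mul1r -[X in X * Num.max _ _]one_pow.
apply: progression_le => //; rewrite ?le_max ?lexx//.
- by lra.
- by rewrite -intrN ler_int.
- by lra.
- rewrite -[2]/(2%:~R) mulr1 -intrM -intrD ler_int; move: k2 qp q1; clear; lia.
- have : (cf_coef alpha n.+1 - e n)%:~R * cf_dist alpha n <=
    Num.max 1 (cf_coef alpha n.+1 - e n)%:~R * cf_dist alpha n.
    by rewrite ler_pM2r// le_max lexx orbT.
  rewrite intrB mulrBl DpE; lra.
Qed.

(** * From the lower limits tau to clustering *)

(** For [beta >= 1] the exponent [(beta + 1) / 2] is at least 1, so the digit factor of [tau_term]
    dominates that of [ostrowski_progression]. *)
Lemma min_digit_le {R : realType} (beta e d : R) :
  1 <= beta -> 0 <= e -> 0 <= d -> (e = 0) \/ 1 <= e ->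
  Num.min (Num.max 1 e `^ beta) (Num.max 1 d)
    <= Num.max 1 (Num.min (e `^ beta) (d `^ ((beta + 1) / 2))).
Proof.
move=> beta1 e0 d0 e01.
have dp : Num.max 1 d <= Num.max 1 (d `^ ((beta + 1) / 2)).
  rewrite ge_max le_max lexx/= le_max; case: (leP d 1) => //= d1.
  by rewrite -[leLHS]powRr1//; apply: ler_powR; [exact: ltW|lra].
have ep : Num.max 1 e `^ beta = Num.max 1 (e `^ beta).
  case: e01 => [->|e1]; last by rewrite !max_r//; apply: powR_ge1 => //; lra.
  by rewrite max_l ?ler01// powR1 powR0 ?max_l ?ler01//; apply/eqP; lra.
by rewrite ep max_minr le_min !ge_min lexx dp orbT.
Qed.

Lemma powR_small {R : realType} (r eps : R) : r < 0 -> 0 < eps ->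
  exists N : nat, forall x : R, N%:R <= x -> x `^ r < eps.
Proof.
move=> r0 eps0; have [N HN] := nat_gt (eps `^ r^-1).
exists N => x Nx; have x_big := lt_le_trans HN Nx.
have e0 : 0 < eps `^ r^-1 by exact: powR_gt0.
have x0 : 0 < x by exact: lt_trans x_big.
rewrite -(@powRV_K R eps r) ?ltW ?lt_eqF//.
rewrite -[r]opprK !(powRN _ (- r)) opprK ltf_pV2 ?posrE ?powR_gt0//.
by apply: lt_powR; rewrite ?oppr_gt0// ltW.
Qed.

(** The parity of [n] is the sign of [q_n alpha - p_n], so differences [q_n] move towards side [b];
    it remains to make the bound of [ostrowski_progression] small. *)
Lemma tau_clusters_at {R : realType} (b : bool) (alpha beta rho t : R) :
  irrational alpha -> 0 < beta -> 0 < t ->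
  (forall (eps : R) (N : nat), 0 < eps -> exists n : nat,
    [/\ (N <= n)%N, odd n = b & (-1) ^+ b * tau_term alpha beta rho n < eps]) ->
  clusters_at b alpha beta rho t.
Proof.
move=> airr beta0 t0 H; apply: progression_clusters => // J N eps J2 eps0.
have [rho0 [_ ez ei _ /(cvg_ostrowski_sum _ _ _ airr) cvg_rho]] := ostrowskiP rho airr.
set e := ostrowski alpha rho in ez ei cvg_rho.
have e_itv i : 0 <= e i <= cf_coef alpha i.+1.
  by case: i => [|i]; [move: ez; clear; lia|exact: ei].
pose c : R := (J%:R + 3) `^ beta * (J%:R + 3).
have c0 : 0 < c by rewrite mulr_gt0 ?powR_gt0// ltr_wpDl ?ltr0n.
pose small n := Num.min (Num.max 1 (e n)%:~R `^ beta)
  (Num.max 1 (cf_coef alpha n.+1 - e n)%:~R)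
  * ((cf_denom alpha n)%:~R `^ beta * cf_dist alpha n) < eps / c.
suff [n [Nn n0 nb smalln]] : exists n, [/\ (N <= n)%N, (0 < n)%N, odd n = b & small n].
  have [K [X [QK DX KX le_f]]] := ostrowski_progression airr beta0 e_itv cvg_rho n0.
  have [_ nq] := cf_denom_ge n airr.
  exists (cf_denom alpha n), K, (cf_dist alpha n), X; split.
    by split => //; [rewrite (le_trans _ nq)// lez_nat|exact: cf_dist_gt0].
  split.
  - by rewrite -nb signr_odd cf_denomM_int.
  - by rewrite -nb signr_odd.
  - have J2R : 2 <= J%:R :> R by rewrite (ler_nat _ 2).
    apply: le_lt_trans (le_f _ J2R) _.
    by rewrite -mulrA mulrC -ltr_pdivlMr.
(* If [beta < 1], then [e_n^beta q_n^beta |{q_n alpha}_2| <= q_(n+1)^(beta - 1)]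
   tends to [0] without any assumption on [tau]. *)
have [beta1|beta1] := ltP beta 1; last first.
  have [n [Nn nb]] := H (eps / c) (maxn N 1) (divr_gt0 eps0 c0).
  have n0 : (0 < n)%N by rewrite (leq_trans _ Nn)// leq_maxr.
  rewrite /tau_term sfrac_cf_denomM// -/e -nb signr_odd mulrCA signrMK => tau_lt.
  exists n; split => //; first by rewrite (leq_trans _ Nn)// leq_maxl.
  apply: le_lt_trans tau_lt; rewrite -mulrA ler_pM2r; last first.
    have [q1 _] := cf_denom_ge n airr.
    by rewrite mulr_gt0 ?cf_dist_gt0// powR_gt0// ltr0z (lt_le_trans ltr01).
  apply: min_digit_le => //.
  - by rewrite ler0z; have /andP[] := e_itv n.
  - by rewrite ler0z subr_ge0; have /andP[] := e_itv n.
  - have /andP[en0 _] := e_itv n; have [->|en] := eqVneq (e n) 0; [by left|right].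
    by move: en0 en; rewrite ler1z; clear; lia.
have [N0 HN0] := @powR_small R (beta - 1) (eps / c)
  (ltac:(by rewrite subr_lt0)) (divr_gt0 eps0 c0).
(* The parity is that of [b], and the 1 keeps [n] positive. *)
pose n := (2 * (maxn (maxn N N0) 1) + b)%N.
exists n; rewrite /n; split; [clear; lia|clear; lia|by rewrite oddD mul2n odd_double oddb|].
have Nn : (N0 <= n)%N by rewrite /n; clear; lia.
rewrite -/n /small; move: (n) Nn => {n} n Nn.
have [_ nq] := cf_denom_ge n.+1 airr.
have [q1 _] := cf_denom_ge n airr.
have := HN0 (cf_denom alpha n.+1)%:~R.
rewrite pmulrn ler_int (le_trans _ nq) ?lez_nat 1?ltnW// => /(_ isT).
apply: le_lt_trans.
have q'0 : 0 < (cf_denom alpha n.+1)%:~R :> R.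
  by have [q'1 _] := cf_denom_ge n.+1 airr; rewrite ltr0z (lt_le_trans ltr01).
rewrite powRB; last by rewrite (gt_eqF q'0) implybT.
rewrite powRr1; last exact: ltW.
rewrite mulrA; apply: ler_pM; last exact: cf_dist_le.
- by rewrite mulr_ge0 ?powR_ge0// le_min powR_ge0 le_max ler01.
- by rewrite ltW ?cf_dist_gt0.
(* As [e_n <= a_(n+1)], the remaining factor is at most [(a_(n+1) q_n) ^ beta <= q_(n+1) ^ beta]. *)
have a1 := cf_coef_ge1 n airr; have /andP[en0 ena] := e_itv n.
have qS : cf_coef alpha n.+1 * cf_denom alpha n <= cf_denom alpha n.+1.
  case: (n) => [|m]; first by rewrite mulr1.
  by rewrite cf_denomSS lerDl; have [qm _] := cf_denom_ge m airr; rewrite (le_trans ler01).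
apply: (@le_trans _ _ ((cf_coef alpha n.+1)%:~R `^ beta * (cf_denom alpha n)%:~R `^ beta)).
  rewrite ler_wpM2r ?powR_ge0// ge_min; apply/orP; left; apply: le_powR; first exact: ltW.
    by rewrite le_max ler01.
  by rewrite ge_max ler1z a1 ler_int.
have a0R : 0 <= (cf_coef alpha n.+1)%:~R :> R by rewrite ler0z (le_trans ler01).
have q0R : 0 <= (cf_denom alpha n)%:~R :> R by rewrite ler0z (le_trans ler01).
rewrite -powRM//.
by apply: le_powR; [exact: ltW|rewrite mulr_ge0|rewrite -intrM ler_int].
Qed.

Lemma tau_plus_clusters_at {R : realType} (alpha beta rho t : R) :
  irrational alpha -> 0 < beta -> 0 < t ->
  tau_plus alpha beta rho = 0%E -> clusters_at false alpha beta rho t.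
Proof.
move=> airr beta0 t0 tau0; apply: tau_clusters_at => // eps N eps0.
have [|n Nn lt_eps] := limf_einf0_lt (V := [set n | (N <= n)%N]) tau0 _ eps0.
  by exists N.
by exists (2 * n)%N; rewrite expr0 mul1r oddM; split => //; move: Nn => /=; lia.
Qed.

Lemma tau_minus_clusters_at {R : realType} (alpha beta rho t : R) :
  irrational alpha -> 0 < beta -> 0 < t ->
  tau_minus alpha beta rho = 0%E -> clusters_at true alpha beta rho t.
Proof.
move=> airr beta0 t0 tau0; apply: tau_clusters_at => // eps N eps0.
(* The strict bound excludes [n = 0], where the truncated index is even. *)
have [|n /= Nn lt_eps] := limf_einf0_lt (V := [set n | (N < n)%N]) tau0 _ eps0.
  by exists N.+1.
exists (2 * n).-1; rewrite expr1 mulN1r; split => //; first by lia.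
by case: n Nn {lt_eps} => // n _; rewrite mulnS /= oddM.
Qed.

(** * Sequences near a root *)

Lemma periodic1_int {R : realType} (T : zmodType) (F : R -> T) (x : R) (m : int) :
  periodic F 1 -> F (x + m%:~R) = F x.
Proof.
move=> Fper; case: m => n.
  by rewrite -pmulrn -(mulr_natr 1) mul1r -[n%:R]/(1 *+ n) periodicn.
rewrite NegzE -{2}(subrK (n.+1%:R) x).
by rewrite -[n.+1%:R in RHS]/(1 *+ n.+1) periodicn// mulrNz -pmulrn.
Qed.

Definition root_expansion {R : realType} (F : R -> R) (r c gamma : R) :=
  forall eps : R, 0 < eps -> exists2 delta : R, 0 < delta & forall x : R, `|x| < delta ->
    `|F (r + x) - c * Num.sg x * `|x| `^ gamma| <= eps * `|x| `^ gamma.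

Definition power_equiv {R : realType} (g : R -> R) (beta : R) :=
  forall eps : R, 0 < eps -> exists A : R, forall t : R, A < t ->
    `|g t - t `^ beta| <= eps * t `^ beta.

Lemma root_expansionP {R : realType} (F : R -> R) (r c gamma : R) :
  (forall x : R, F (r + x) = c * Num.sg x * `|x| `^ gamma
     +o_(x \near 0) (`|x| `^ gamma)) -> root_expansion F r c gamma.
Proof.
move=> FE eps eps0.
have /eqaddoE/eqaddoP/(_ _ eps0) := funext FE.
move=> /nbhs_ballP[delta /= delta0 H]; exists delta => // x xd.
have := H x; rewrite /ball /= sub0r normrN => /(_ xd).
by rewrite [X in _ <= _ * X -> _]ger0_norm// powR_ge0.
Qed.

Lemma power_equivP {R : realType} (g : R -> R) (beta : R) :
  (forall t : R, g t = t `^ beta +o_(t \near +oo) (t `^ beta)) -> power_equiv g beta.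
Proof.
move=> gE eps eps0.
have /eqaddoE/eqaddoP/(_ _ eps0) := funext gE.
move=> [A [_ H]]; exists A => t At.
by have := H t At; rewrite [X in _ <= _ * X -> _]ger0_norm// powR_ge0.
Qed.

Lemma root_expansionN {R : realType} (F : R -> R) (r c gamma : R) :
  root_expansion F r c gamma -> root_expansion (\- F) r (- c) gamma.
Proof.
move=> H eps eps0; have [d d0 Hd] := H eps eps0; exists d => // x xd.
by rewrite !mulNr -opprD normrN Hd.
Qed.

Lemma powR_div_comp {R : realType} (k x beta gamma : R) :
  0 <= k -> 0 <= x -> gamma != 0 ->
  (k `^ (beta / gamma) * x) `^ gamma = k `^ beta * x `^ gamma.
Proof. by move=> k0 x0 g0; rewrite powRM ?powR_ge0// -powRrM divfK. Qed.

(** The power [gamma] maps the interval from [lo] to [hi] onto the one of radius [eta] around [w].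
    As [k ^ (beta / gamma) * x] stays below [hi], large [k] forces small [x]. *)
Lemma clusters_at_powR {R : realType} (b : bool) (alpha beta gamma rho w eta delta : R)
    (N : nat) :
  0 < beta -> 0 < gamma -> 0 < eta < w -> 0 < delta ->
  (forall t, 0 < t -> clusters_at b alpha (beta / gamma) rho t) ->
  exists k : nat, exists2 x : R, (N <= k)%N & 
    [/\ 0 < x, x < delta, sfrac (k%:R * alpha - rho) = (-1) ^+ b * x &
        `|k%:R `^ beta * x `^ gamma - w| < eta].
Proof.
move=> beta0 gamma0 /andP[eta0 etaw] delta0 acc.
pose t := w `^ gamma^-1; pose lo := (w - eta) `^ gamma^-1; pose hi := (w + eta) `^ gamma^-1.
have ig0 : 0 < gamma^-1 by rewrite invr_gt0.
have lo0 : 0 < lo by rewrite powR_gt0; lra.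
have lot : lo < t by apply: lt_powR => //; lra.
have thi : t < hi by apply: lt_powR => //; lra.
have t0 : 0 < t by lra.
have bg0 : 0 < beta / gamma by rewrite divr_gt0.
have [N0 HN0] := @powR_small R (- (beta / gamma)) (delta / hi) (ltac:(by rewrite oppr_lt0))
  (ltac:(by rewrite divr_gt0//; lra)).
have e0 : 0 < Num.min (t - lo) (hi - t) by rewrite lt_min; lra.
have [k Nk] := acc t t0 _ (maxn (maxn N N0) 1) e0.
rewrite lt_min !ltr_norml.
set s := sfrac _; set v := _ * _ => /andP[/andP[v1 _] /andP[_ v2]].
have lov : lo < v by lra.
have vhi : v < hi by lra.
have k1 : (0 < k)%N by rewrite (leq_trans _ Nk)// leq_maxr.
have N0k : (N0 <= k)%N by rewrite (leq_trans _ Nk)// -maxnA maxnCA leq_maxl.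
have K0 : 0 < k%:R `^ (beta / gamma) :> R by rewrite powR_gt0// ltr0n.
have x0 : 0 < (-1) ^+ b * s by rewrite -(pmulr_rgt0 _ K0) -/v; lra.
exists k, ((-1) ^+ b * s); first by rewrite (leq_trans _ Nk)// -maxnA leq_maxl.
split => //.
- have := HN0 k%:R; rewrite ler_nat N0k powRN => /(_ isT).
  rewrite ltr_pdivlMr ?(lt_trans lo0 (lt_trans lot thi))//; apply: lt_trans.
  by rewrite ltr_pdivlMl.
- by rewrite signrMK.
rewrite -powR_div_comp ?ler0n ?ltW ?gt_eqF// -/v.
have := lt_powR gamma0 (ltW lo0) lov; have := lt_powR gamma0 (ltW (lt_trans lo0 lov)) vhi.
rewrite /lo /hi !powRV_K ?gt_eqF//; try lra.
by rewrite ltr_norml => ? ?; apply/andP; split; lra.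
Qed.

Lemma dense_of_clusters {R : realType} (b : bool) (alpha beta gamma r c : R)
    (g F : R -> R) :
  0 < beta -> 0 < gamma -> 0 < (-1) ^+ b * c ->
  periodic F 1 -> power_equiv g beta -> root_expansion F r c gamma ->
  (forall t, 0 < t -> clusters_at b alpha (beta / gamma) r t) ->
  seq_dense_in (fun k : nat => g k%:R * F (k%:R * alpha)) [set x | 0 < x].
Proof.
move=> beta0 gamma0; set C := _ * c => C0 Fper gE FE acc y /= y0.
move=> B /nbhs_ballP[eta /= eta0 etaB].
have [w w0 CwE] : exists2 w, 0 < w & C * w = y.
  by exists (y / C); [rewrite divr_gt0|rewrite mulrC divfK// gt_eqF].
(* [eta1] controls [k ^ beta * x ^ gamma], and [eps] the two asymptotics; each accounts for half of
   [eta]. The factor [2 * w] bounds [k ^ beta * x ^ gamma]. *)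
pose eta1 := Num.min (w / 2) (eta / 2 / C).
pose eps := Num.min 1 (eta / 2 / (2 * w * (2 + C))).
have den0 : 0 < 2 * w * (2 + C). by rewrite !mulr_gt0// addr_gt0.
have eps0 : 0 < eps by rewrite lt_min ltr01 !divr_gt0.
have eta1_itv : 0 < eta1 < w.
  rewrite lt_min !divr_gt0//= gt_min; apply/orP; left.
  by rewrite ltr_pdivrMr//; lra.
have [A gA] := gE eps eps0; have [delta delta0 Fdelta] := FE eps eps0.
have [N AN] := nat_gt A.
have d0 : 0 < Num.min delta 1 by rewrite lt_min delta0 ltr01.
have [k [x Nk [x0 xd sx Wk]]] :=
  clusters_at_powR (maxn N 1) beta0 gamma0 eta1_itv d0 acc.
exists (g k%:R * F (k%:R * alpha)); split.
  by exists k => //=; rewrite (leq_trans _ Nk)// leq_maxr.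
apply: etaB; rewrite /ball /= distrC.
have kx : k%:R * alpha = r + (-1) ^+ b * x + (Num.floor (k%:R * alpha - r + 2^-1))%:~R.
  by rewrite -sx /sfrac; ring.
have FkE : F (k%:R * alpha) = F (r + (-1) ^+ b * x) by rewrite kx periodic1_int.
have norm_x : `|(-1) ^+ b * x| = x by rewrite normrMsign gtr0_norm.
have sgr_x : Num.sg ((-1) ^+ b * x) = (-1) ^+ b by rewrite sgrM (gtr0_sg x0) mulr1 sgrX sgrN1.
have := Fdelta ((-1) ^+ b * x); rewrite norm_x sgr_x => /(_ _)/[!(mulrC c)].
rewrite -/C (lt_le_trans xd) ?ge_min ?lexx// => /(_ isT).
have := gA k%:R; rewrite (lt_le_trans AN); last first.
  by rewrite ler_nat (leq_trans _ Nk)// leq_maxl.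
move=> /(_ isT).
rewrite FkE; move: Wk; set K := k%:R `^ beta; set X := x `^ gamma.
have K0 : 0 <= K := powR_ge0 _ _.
have X0 : 0 <= X := powR_ge0 _ _.
move: (g _) (F _) => G f Wk Gk fX.
have eps1 : eps <= 1 by rewrite ge_min lexx.
have epsE : eps * (2 * w * (2 + C)) <= eta / 2 by rewrite -ler_pdivlMr// ge_min lexx orbT.
have eta1w : eta1 <= w / 2 by rewrite ge_min lexx.
have eta1C : C * eta1 <= eta / 2 by rewrite mulrC -ler_pdivlMr// ge_min lexx orbT.
have KX0 : 0 <= K * X by rewrite mulr_ge0.
have KXw : K * X <= 2 * w by move: Wk; rewrite ltr_norml => /andP[]; lra.
(* The condition [eps <= 1] makes the product of the two errors linear in [eps]; the first three
   terms then total at most [eps * (K * X) * (2 + C)]. *)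
rewrite (_ : G * f - y = (G - K) * (f - C * X) + (G - K) * (C * X)
  + K * (f - C * X) + C * (K * X - w)); last first.
  by rewrite -CwE; ring.
have e1 : `|(G - K) * (f - C * X)| <= eps * (K * X).
  rewrite normrM; apply: le_trans (ler_pM (normr_ge0 _) (normr_ge0 _) Gk fX) _.
  rewrite mulrACA -subr_ge0 -mulrBl mulr_ge0//; nra.
have e2 : `|(G - K) * (C * X)| <= eps * C * (K * X).
  rewrite normrM (ger0_norm (mulr_ge0 (ltW C0) X0)).
  rewrite (_ : eps * C * _ = (eps * K) * (C * X)); last by ring.
  by rewrite ler_wpM2r// mulr_ge0// ltW.
have e3 : `|K * (f - C * X)| <= eps * (K * X).
  by rewrite normrM (ger0_norm K0) mulrCA ler_wpM2l.
have e4 : `|C * (K * X - w)| < eta / 2.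
  by rewrite normrM (gtr0_norm C0); apply: lt_le_trans eta1C; rewrite ltr_pM2l.
have e5 : eps * (K * X) * (2 + C) <= eta / 2.
  apply: le_trans epsE; rewrite -mulrA ler_pM2l// ler_pM2r//; lra.
apply: le_lt_trans (ler_normD _ _) _.
have := ler_normD ((G - K) * (f - C * X) + (G - K) * (C * X)) (K * (f - C * X)).
have := ler_normD ((G - K) * (f - C * X)) ((G - K) * (C * X)).
lra.
Qed.

(** * Necessity of the condition on mu *)

(** To force [k >= N], shrink [eps] until none of the first [N] terms lies strictly between 0 and
    it. *)
Lemma dense_small_positive {R : realType} (u : nat -> R) (eps : R) (N : nat) :
  seq_dense_in u [set x | 0 < x] -> 0 < eps ->
  exists2 k : nat, (N <= k)%N & 0 < u k < eps.
Proof.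
move=> u_dense eps0.
have [e /andP[e0 ele] eN] : exists2 e, 0 < e <= eps &
    forall k, (k < N)%N -> ~~ (0 < u k < e).
  elim: N => [|N [e /andP[e0 ele] eN]]; first by exists eps; rewrite ?eps0/=.
  have [uN|uN] := boolP (0 < u N < e).
    case/andP: uN => uN0 uNe; exists (u N).
      by rewrite uN0 ltW// (lt_le_trans uNe).
    move=> k; rewrite ltnS leq_eqVlt => /predU1P[->|/eN]; first by rewrite ltxx andbF.
    by apply: contra => /andP[-> /= /lt_trans]; exact.
  exists e; first by rewrite e0.
  by move=> k; rewrite ltnS leq_eqVlt => /predU1P[->|/eN].
have e20 : 0 < e / 2 by rewrite divr_gt0.
have [] := u_dense (e / 2) e20 (ball (e / 2) (e / 2)).
  exact: nbhsx_ballx.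
move=> _ [[k _ <-]]; rewrite /ball /= ltr_norml => /andP[u1 u2].
have uk : 0 < u k < e by apply/andP; split; lra.
exists k; last by case/andP: uk => -> /= /lt_le_trans; exact.
by rewrite leqNgt; apply/negP => /eN; rewrite uk.
Qed.

(** Choose [s n >= n] satisfying [P] at [1 / (n + 1)]; compactness of [[0, 1]] gives [r], and
    monotonicity of [P] reaches every [eps]. *)
Lemma frac_cluster {R : realType} (alpha : R) (P : R -> nat -> Prop) :
  (forall (eps : R) (N : nat), 0 < eps -> exists2 k, (N <= k)%N & P eps k) ->
  (forall e e' k, e <= e' -> P e k -> P e' k) ->
  exists r : R, forall (delta eps : R) (N : nat), 0 < delta -> 0 < eps ->
    exists2 k, (N <= k)%N & P eps k /\ `|frac (k%:R * alpha) - r| < delta.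
Proof.
move=> HP Pmono.
have /choice[s sP] : forall n : nat, exists k, (n <= k)%N /\ P n.+1%:R^-1 k.
  by move=> n; have [|k] := HP n.+1%:R^-1 n; [rewrite invr_gt0 ltr0n|exists k].
pose z n := frac ((s n)%:R * alpha).
have z01 n : 0 <= z n <= 1.
  have := ge_floor ((s n)%:R * alpha); have := floorD1_gt ((s n)%:R * alpha).
  by rewrite /z /frac intrD; move: (_ * alpha) => x ? ?; apply/andP; split; lra.
have [|r [_ rcl]] := @segment_compact R 0 1 (z @ \oo) _.
  by exists 0%N => // n _; rewrite /= in_itv /= z01.
exists r => delta eps N delta0 eps0.
have [M Meps] := nat_gt eps^-1.
have [|x [[n Mn <-] rx]] :=
  rcl [set z n | n in [set n | (maxn M N <= n)%N]]
    (ball r delta) _ (nbhsx_ballx _ _ delta0).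
  by exists (maxn M N) => // n /= Mn; exists n.
have [ns Ps] := sP n.
exists (s n); first by rewrite (leq_trans _ ns)// (leq_trans _ Mn)// leq_maxr.
split; last by rewrite distrC.
apply: Pmono Ps; rewrite invf_ple ?posrE ?ltr0n//.
apply: le_trans (ltW Meps) _; rewrite ler_nat (leq_trans _ (leqnSn n))//.
by rewrite (leq_trans _ Mn)// leq_maxl.
Qed.

Lemma approximable_of_dense {R : realType} (alpha beta : R) (g F gamma c : R -> R) :
  0 < beta -> continuous F -> periodic F 1 -> power_equiv g beta ->
  (forall r, F r = 0 -> [/\ 0 < gamma r, c r != 0 & root_expansion F r (c r) (gamma r)]) ->
  seq_dense_in (fun k : nat => g k%:R * F (k%:R * alpha)) [set x | 0 < x] ->
  exists r : R, F r = 0 /\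
    ((0 < c r /\ approximable false alpha (beta / gamma r) r) \/
     (c r < 0 /\ approximable true alpha (beta / gamma r) r)).
Proof.
move=> beta0 Fcont Fper gE FE u_dense; set u := (fun k => _) in u_dense.
have [r rP] := @frac_cluster R alpha (fun eps k => 0 < u k < eps)
  (fun eps N => dense_small_positive N u_dense)
  (fun e e' k ee' => ltac:(by case/andP=> -> /= /lt_le_trans; exact)).
have [A gA] := gE (2^-1) (ltac:(by rewrite invr_gt0)).
have [N0 AN0] := nat_gt A.
have g_ge k : (N0 <= k)%N -> k%:R `^ beta / 2 <= g k%:R.
  move=> Nk; have := gA k%:R; rewrite (lt_le_trans AN0) ?ler_nat// => /(_ isT).
  by rewrite ler_norml => /andP[]; lra.
have F_frac k : F (k%:R * alpha) = F (frac (k%:R * alpha)).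
  by rewrite /frac -mulrNz periodic1_int.
(* Otherwise, near [r] and for large [k], [g >= 1 / 2] and [|F| > |F r| / 2] keep [|u k|] above
   [|F r| / 4]. *)
have Fr0 : F r = 0.
  apply/eqP; apply: contrapT => /negP Fr.
  have Fr2 : 0 < `|F r| / 2 by rewrite divr_gt0// normr_gt0.
  have /cvgrPdist_lt/(_ _ Fr2)/nbhs_ballP[delta /= delta0 Fd] := Fcont r.
  have Fr4 : 0 < `|F r| / 2 / 2 by rewrite divr_gt0.
  have [k Nk [/andP[uk0 uk] kr]] := rP delta (`|F r| / 2 / 2) (maxn N0 1) delta0 Fr4.
  have := Fd (frac (k%:R * alpha)); rewrite /ball /= distrC kr => /(_ isT).
  rewrite -F_frac => FrF.
  have FrN : `|F r| / 2 < `|F (k%:R * alpha)|.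
    have := ler_distD (F (k%:R * alpha)) (F r) 0; rewrite !subr0; lra.
  have k1 : 1 <= k%:R `^ beta.
    by apply: powR_ge1; [exact: ltW|rewrite ler1n (leq_trans _ Nk)// leq_maxr].
  have gk := g_ge k (leq_trans (leq_maxl _ _) Nk).
  have gk0 : 0 < g k%:R by lra.
  move: uk uk0; rewrite /u pmulr_rgt0// => uk Fk0; rewrite (gtr0_norm Fk0) in FrN.
  have : 2^-1 * F (k%:R * alpha) <= g k%:R * F (k%:R * alpha) by rewrite ler_pM2r//; lra.
  lra.
have [gamma0 cn0 FEr] := FE r Fr0; exists r; split => //.
(* The sign of [c r] dictates the side, since [u k] is positive. *)
suff approx (b : bool) : 0 < (-1) ^+ b * c r -> approximable b alpha (beta / gamma r) r.
  have [c0|c0|c0] := ltgtP (c r) 0.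
  - by right; split => //; apply: approx; rewrite expr1 mulN1r oppr_gt0.
  - by left; split => //; apply: approx; rewrite expr0 mul1r.
  - by rewrite c0 eqxx in cn0.
set C := _ * c r => C0 eps N eps0.
(* With error [C / 2], [F] keeps the sign of [y] and is at least [C / 2 * y ^ gamma] for [y > 0];
   together with [g >= k ^ beta / 2] this gives the divisor 4 below. *)
have [delta delta0 Fd] := FEr (C / 2) (ltac:(by rewrite divr_gt0)).
have e'0 : 0 < C * eps `^ gamma r / 4 by rewrite divr_gt0// mulr_gt0// powR_gt0.
have d'0 : 0 < Num.min delta 2^-1 by rewrite lt_min delta0 invr_gt0 ltr0n.
have [k Nk [/andP[uk0 uk]]] := rP _ _ (maxn (maxn N N0) 1) d'0 e'0.
rewrite lt_min; set x := _ - r => /andP[xd x2].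
have gk : k%:R `^ beta / 2 <= g k%:R.
  by apply: g_ge; rewrite (leq_trans _ Nk)// -maxnA maxnCA leq_maxl.
have K0 : 0 < k%:R `^ beta :> R.
  by rewrite powR_gt0// ltr0n (leq_trans _ Nk)// leq_maxr.
have gk0 : 0 < g k%:R by lra.
move: uk0 uk; rewrite /u F_frac pmulr_rgt0//.
have -> : frac (k%:R * alpha) = r + x by rewrite /x addrC subrK.
move=> Fx0 uk; have := Fd x xd => Fx.
have xn0 : x != 0.
  by apply: contraTneq Fx0 => ->; rewrite addr0 Fr0 ltxx.
have X0 : 0 < `|x| `^ gamma r by rewrite powR_gt0// normr_gt0.
pose y := (-1) ^+ b * x.
have xy : x = (-1) ^+ b * y by rewrite signrMK.
have normy : `|x| = `|y| by rewrite /y normrMsign.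
have sgy : c r * Num.sg x = C * Num.sg y.
  by rewrite /y /C sgrM sgrX sgrN1 mulrACA -expr2 sqrr_sign mul1r.
rewrite sgy normy in Fx; rewrite normy in X0 x2; rewrite xy in xn0.
move: Fx; rewrite ler_norml => /andP[Fx Fx'].
have CX : 0 < C * `|y| `^ gamma r by rewrite mulr_gt0.
have y0 : 0 < y.
  have [//|y0|y0] := ltgtP 0 y; last by rewrite -y0 mulr0 eqxx in xn0.
  by move: Fx'; rewrite ltr0_sg//; lra.
rewrite gtr0_sg// mulr1 in Fx; rewrite gtr0_norm// in Fx CX X0 x2.
have yE : sfrac (k%:R * alpha - r) = (-1) ^+ b * y.
  apply: sfrac_sign; first by rewrite y0.
  rewrite -xy (_ : _ - x = (Num.floor (k%:R * alpha))%:~R) ?intr_int//.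
  by rewrite /x /frac; ring.
exists k; first by rewrite (leq_trans _ Nk)// -maxnA leq_maxl.
rewrite yE signrMK; split=> //; rewrite ltNge; apply/negP => eps_le.
have := le_powR (ltW gamma0) (ltW eps0) eps_le.
rewrite powR_div_comp ?ler0n ?(ltW y0) ?gt_eqF//.
have : C / 2 * y `^ gamma r <= F (r + x) by lra.
move: K0 gk uk Fx0 X0 {gA AN0 g_ge}.
move: (k%:R `^ beta) (y `^ gamma r) (eps `^ gamma r) (F (r + x)) (g k%:R) C0.
clear; move: C => C K X E f G C0 K0 GK uk f0 X0 fX EKX.
have : (K / 2) * (C / 2 * X) <= G * f.
  by apply: ler_pM => //; rewrite ltW ?mulr_gt0 ?divr_gt0.
have : C * E <= C * (K * X) by rewrite ler_pM2l.
lra.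
Qed.

(** The positive half, for arbitrary [F] and [c] so that it also applies to [\- F] and [- c]. *)
Lemma dense_conditions {R : realType} (alpha beta : R) (g F gamma c : R -> R) :
  irrational alpha -> 0 < beta -> continuous F -> periodic F 1 -> power_equiv g beta ->
  (forall r, F r = 0 -> [/\ 0 < gamma r, c r != 0 & root_expansion F r (c r) (gamma r)]) ->
  let dense := seq_dense_in (fun k : nat => g k%:R * F (k%:R * alpha)) [set x | 0 < x] in
  let mu_cond r := F r = 0 /\
    ((0 < c r /\ mu_plus alpha (beta / gamma r) r = 0%E) \/
     (c r < 0 /\ mu_minus alpha (beta / gamma r) r = 0%E)) in
  let tau_cond r := F r = 0 /\
    ((0 < c r /\ tau_plus alpha (beta / gamma r) r = 0%E) \/
     (c r < 0 /\ tau_minus alpha (beta / gamma r) r = 0%E)) in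
  [/\ dense -> exists r, mu_cond r,
      (exists r, rational r /\ mu_cond r) -> dense &
      (exists r, tau_cond r) -> dense].
Proof.
move=> airr beta0 Fcont Fper gE FE dense mu_cond tau_cond.
have dense_of (b : bool) r : F r = 0 -> 0 < (-1) ^+ b * c r ->
    (forall t, 0 < t -> clusters_at b alpha (beta / gamma r) r t) -> dense.
  move=> Fr cr acc; have [gamma0 _ FEr] := FE r Fr.
  exact: (dense_of_clusters beta0 gamma0 cr Fper gE FEr acc).
have bg0 r : F r = 0 -> 0 < beta / gamma r.
  by move=> /FE[gamma0 _ _]; rewrite divr_gt0.
have pos r : 0 < c r -> 0 < (-1) ^+ false * c r by rewrite mul1r.
have neg r : c r < 0 -> 0 < (-1) ^+ true * c r by rewrite mulN1r oppr_gt0.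
split.
- move=> /(approximable_of_dense beta0 Fcont Fper gE FE)[r [Fr H]]; exists r; split => //.
  by case: H => -[cr H]; [left|right]; split => //; [apply/mu_plus_eq0P|apply/mu_minus_eq0P].
- move=> [r [rrat [Fr [[cr /mu_plus_eq0P H]|[cr /mu_minus_eq0P H]]]]].
  + by apply: (dense_of _ _ Fr (pos _ cr)) => t t0;
      apply: rational_clusters_at => //; exact: bg0.
  + by apply: (dense_of _ _ Fr (neg _ cr)) => t t0;
      apply: rational_clusters_at => //; exact: bg0.
- move=> [r [Fr [[cr H]|[cr H]]]].
  + by apply: (dense_of _ _ Fr (pos _ cr)) => t t0;
      apply: tau_plus_clusters_at => //; exact: bg0.
  + by apply: (dense_of _ _ Fr (neg _ cr)) => t t0;
      apply: tau_minus_clusters_at => //; exact: bg0.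
Qed.

Lemma seq_dense_inN {R : realType} (u : nat -> R) :
  seq_dense_in (fun k => - u k) [set x | 0 < x] <-> seq_dense_in u [set x | x < 0].
Proof.
split=> H x /= x0 B /nbhs_ballP[e /= e0 eB].
  have [|_ [[k k0 <-] kx]] := H (- x) _ (ball (- x) e) (nbhsx_ballx _ _ e0).
    by rewrite /= oppr_gt0.
  exists (u k); split; first by exists k.
  move: kx; rewrite /ball /= opprK => kx.
  by apply: eB; rewrite /ball /= -normrN opprB addrC.
have [|_ [[k k0 <-] kx]] := H (- x) _ (ball (- x) e) (nbhsx_ballx _ _ e0).
  by rewrite /= oppr_lt0.
exists (- u k); split; first by exists k.
by apply: eB; rewrite /ball /= opprK -normrN opprD.
Qed.

Theorem theorem1p1 (R : realType) (alpha beta : R) (g F gamma c : R -> R)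
  (alpha_irr : irrational alpha)
  (beta_gt0 : 0 < beta)
  (g_gt0 : forall t : R, 0 < t -> 0 < g t)
  (g_asymp : forall t : R, g t = t `^ beta +o_(t \near +oo) (t `^ beta))
  (F_cont : continuous F)
  (F_periodic : periodic F 1)
  (F_isolated : forall r : R, F r = 0 -> isolated [set x : R | F x = 0] r)
  (gamma_gt0 : forall r : R, F r = 0 -> 0 < gamma r)
  (c_neq0 : forall r : R, F r = 0 -> c r != 0)
  (F_asymp : forall r : R, F r = 0 -> forall x : R,
     F (r + x) = c r * Num.sg x * `|x| `^ gamma r
       +o_(x \near 0) (`|x| `^ gamma r)) :
  let u := fun k : nat => g k%:R * F (k%:R * alpha) in
  let Rpos := [set x : R | 0 < x] in
  let Rneg := [set x : R | x < 0] in
  let mu_cond_pos := fun r : R => F r = 0 /\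
    ((0 < c r /\ mu_plus alpha (beta / gamma r) r = 0%E) \/
     (c r < 0 /\ mu_minus alpha (beta / gamma r) r = 0%E)) in
  let mu_cond_neg := fun r : R => F r = 0 /\
    ((c r < 0 /\ mu_plus alpha (beta / gamma r) r = 0%E) \/
     (0 < c r /\ mu_minus alpha (beta / gamma r) r = 0%E)) in
  let tau_cond_pos := fun r : R => F r = 0 /\
    ((0 < c r /\ tau_plus alpha (beta / gamma r) r = 0%E) \/
     (c r < 0 /\ tau_minus alpha (beta / gamma r) r = 0%E)) in
  let tau_cond_neg := fun r : R => F r = 0 /\
    ((c r < 0 /\ tau_plus alpha (beta / gamma r) r = 0%E) \/
     (0 < c r /\ tau_minus alpha (beta / gamma r) r = 0%E)) in
  ((seq_dense_in u Rpos -> exists r : R, mu_cond_pos r) /\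
   (seq_dense_in u Rneg -> exists r : R, mu_cond_neg r) /\
   ((exists r : R, rational r /\ mu_cond_pos r) -> seq_dense_in u Rpos) /\
   ((exists r : R, rational r /\ mu_cond_neg r) -> seq_dense_in u Rneg)) /\
  (((exists r : R, tau_cond_pos r) -> seq_dense_in u Rpos) /\
   ((exists r : R, tau_cond_neg r) -> seq_dense_in u Rneg)).
Proof.
move=> u Rpos Rneg mu_cond_pos mu_cond_neg tau_cond_pos tau_cond_neg.
have gE := power_equivP g_asymp.
have FE r : F r = 0 -> [/\ 0 < gamma r, c r != 0 & root_expansion F r (c r) (gamma r)].
  by move=> Fr; split; [exact: gamma_gt0|exact: c_neq0|exact/root_expansionP/F_asymp].
have FNE r : - F r = 0 ->
    [/\ 0 < gamma r, - c r != 0 & root_expansion (\- F) r (- c r) (gamma r)].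
  move=> /eqP; rewrite oppr_eq0 => /eqP /FE[? ? ?]; rewrite oppr_eq0; split=> //.
  exact: root_expansionN.
have FN_cont : continuous (\- F) by move=> x; apply: cvgN; exact: F_cont.
have FN_per : periodic (\- F) 1 by move=> x; rewrite /= F_periodic.
have [mu_pos rat_pos tau_pos] := dense_conditions alpha_irr beta_gt0 F_cont F_periodic gE FE.
(* Density of [u] in the negatives is density of [- u] in the positives; negating [F] negates [c]
   and keeps [gamma]. *)
have [mu_neg rat_neg tau_neg] := dense_conditions alpha_irr beta_gt0 FN_cont FN_per gE FNE.
have uN : (fun k : nat => g k%:R * (\- F) (k%:R * alpha)) = (fun k => - u k).
  by apply/funext => k; rewrite /= mulrN.
rewrite uN in mu_neg rat_neg tau_neg.
have FN0 r : (- F r = 0) <-> (F r = 0).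
  by split=> [/eqP|->]; rewrite ?oppr0// oppr_eq0 => /eqP.
split; split => //; first split.
- move=> /seq_dense_inN/mu_neg[r [/FN0 Fr H]]; exists r; split => //.
  by rewrite oppr_gt0 oppr_lt0 in H.
- split=> // -[r [rrat [Fr H]]]; apply/seq_dense_inN/rat_neg; exists r; split => //.
  by split; [exact/FN0|rewrite oppr_gt0 oppr_lt0].
- move=> [r [Fr H]]; apply/seq_dense_inN/tau_neg; exists r.
  by split; [exact/FN0|rewrite oppr_gt0 oppr_lt0].
Qed.
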